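(* Let $G$ be an $F_6$-free graph with $m\geq 88$ edges. Then $$\lambda(G)\leq \frac{1+\sqrt{4m-3}}{2},$$ and equality holds if and only if $G\cong K_2\vee \frac{m-1}{2}K_1$.
   Context: All graphs are simple, finite and undirected. $\lambda(G)$ denotes the spectral radius (largest adjacency eigenvalue) of $G$. $P_n$ is the path on $n$ vertices, $K_n$ the complete graph, and $tK_1$ the empty graph on $t$ vertices. The join $G\vee H$ is obtained from the disjoint union $G\cup H$ by adding all edges between $V(G)$ and $V(H)$. The fan graph is $F_k=K_1\vee P_{k-1}$ (so $F_6=K_1\vee P_5$). A graph is $F$-free if it contains no subgraph isomorphic to $F$.
   Formalization: The equality case is stated up to isolated vertices: equality holds iff G with its isolated vertices removed is isomorphic to K_2 ∨ ((m-1)/2)K_1, since adding isolated vertices to that graph changes neither m nor λ(G). *)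

(* Defs.v *)
From HB Require Import structures.
From mathcomp Require Import all_boot all_order all_algebra.
From mathcomp Require Import classical_sets reals.
Set Implicit Arguments. Unset Strict Implicit. Unset Printing Implicit Defensive.
Import Order.TTheory GRing.Theory Num.Theory.

Definition simple_graph (T : finType) (e : rel T) : Prop :=
  symmetric e /\ irreflexive e.

Definition edges (T : finType) (e : rel T) : {set {set T}} :=
  [set [set p.1; p.2] | p in [set p : T * T | e p.1 p.2]].
Definition nedges (T : finType) (e : rel T) : nat := #|edges e|.

(* Adjacency matrix (vertices indexed through enum_val) and spectral radius
   = largest adjacency eigenvalue (sup of the finite set of eigenvalues). *)
Definition adjmx (R : realType) (T : finType) (e : rel T) : 'M[R]_#|T| :=
  \matrix_(i, j) ((e (enum_val i) (enum_val j))%:R)%R.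
Definition spec_rad (R : realType) (T : finType) (e : rel T) : R :=
  sup [set a : R | eigenvalue (adjmx R e) a].

Definition contains_sub (T1 T2 : finType) (h : rel T1) (e : rel T2) : Prop :=
  exists f : T1 -> T2, injective f /\ forall x y, h x y -> e (f x) (f y).

Definition path_rel (n : nat) : rel 'I_n :=
  fun i j => (i.+1 == j :> nat) || (j.+1 == i :> nat).
Definition complete_rel (n : nat) : rel 'I_n := fun i j => i != j.
Definition empty_rel (n : nat) : rel 'I_n := fun _ _ => false.

Definition join_rel (T1 T2 : finType) (g : rel T1) (h : rel T2) : rel (T1 + T2) :=
  fun u v => match u, v with
             | inl x, inl y => g x y
             | inr x, inr y => h x y
             | _, _ => true
             end.

Definition F6 : rel ('I_1 + 'I_5) := join_rel (@empty_rel 1) (@path_rel 5).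
Definition F6_free (T : finType) (e : rel T) : Prop := ~ contains_sub F6 e.

Definition isomorphic (T1 T2 : finType) (e1 : rel T1) (e2 : rel T2) : Prop :=
  exists f : T1 -> T2, bijective f /\ forall x y, e2 (f x) (f y) = e1 x y.

Definition nonisol (T : finType) (e : rel T) := {x : T | [exists y, e x y]}.
Definition nonisol_rel (T : finType) (e : rel T) : rel (nonisol e) :=
  fun x y => e (val x) (val y).

Arguments nonisol_rel {T} e.
Arguments spec_rad R {T} e.
Arguments adjmx R {T} e.
Arguments empty_rel n : clear implicits.
Arguments complete_rel n : clear implicits.
Arguments path_rel n : clear implicits.

(* Main.v *)
Require Import Defs.
From HB Require Import structures.
From mathcomp Require Import all_boot all_order all_algebra.
From mathcomp Require Import ring lra zify.
Import Order.TTheory GRing.Theory Num.Theory.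
Local Open Scope ring_scope.
Set Implicit Arguments. Unset Strict Implicit. Unset Printing Implicit Defensive.

(** Let [x] be a nonnegative eigenvector for the spectral radius [lam], scaled
    so that its maximum [x u] is 1; put [A = N(u)] and let [B] be the remaining
    vertices.  Writing [d] for the degree into [A],
      lam^2 - lam - (m - 1)
        = 1 + eta(A) - sum_B d(b) (1 - x b) - e(B),
      eta(S) = sum_S ((d(w) - 1) x w - d(w) / 2).
    The eigenvalue equation at [b] bounds [lam (1 - x b)] below by the weight of
    the vertices of [A] that [b] misses, up to its degree in [B]; this turns the
    two subtracted sums into at least [Phi(A) / lam], where [Phi] is
    superadditive over disjoint subsets of [A].

    Since the graph has no fan centred at [u], the link [G[A]] has no path on
    five vertices, so it splits into isolated vertices, double stars, triangles
    with pendants at one vertex, and components on a 4-cycle.  A component [C]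
    with a cycle satisfies [Phi(C) > lam (1 + eta(C))]: if its entries are so
    large that [1 + eta(C) >= 0], it needs about [lam] neighbours in [B] per
    unit of weight, but fans centred in [C] prevent those from seeing most of
    [C].  A double star has [1 + eta <= 0], an isolated vertex has [eta < 0].
    Hence [lam^2 - lam >= m - 1] forces [A] to be a single double star with
    equality everywhere, and this yields [K_2] joined to an independent set. *)

(** * Inequalities for the cyclic components *)

(* In the pointwise lemmas [r_i] tells whether a fixed vertex of [B] is adjacent
   to the [i]-th vertex of the component; in the final lemmas [t] is the total
   number of edges to [B]. *)
Section Numeric.
Variable R : realFieldType.
Implicit Types (lam s t : R) (r : bool).

(** A vertex of [B] that sees at most one vertex of a [K_4] misses all of the total weight except
    one entry, and that entry is at most 1. *)
Lemma K4_pointwise (x1 x2 x3 x4 : R) r1 r2 r3 r4 :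
  x1 <= 1 -> x2 <= 1 -> x3 <= 1 -> x4 <= 1 ->
  ~~ (r1 && r2) -> ~~ (r1 && r3) -> ~~ (r1 && r4) -> ~~ (r2 && r3) -> ~~ (r2 && r4) ->
  ~~ (r3 && r4) ->
  (x1 + x2 + x3 + x4 - 1) * (r1%:R + (r2%:R + (r3%:R + (r4%:R + 0)))) <=
  (r1%:R + (r2%:R + (r3%:R + (r4%:R + 0)))) *
  ((1 - r1%:R) * x1 + ((1 - r2%:R) * x2 + ((1 - r3%:R) * x3 + ((1 - r4%:R) * x4 + 0)))).
Proof. by case: r1; case: r2; case: r3; case: r4 => //= *; lra. Qed.

(** Here [2 * s - 5] is [1 + eta], and the bound on [t] adds up the lower bounds for the edges from
    the four vertices to [B]. With [t] at that bound, the difference of the two sides is affine in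
    [lam] with slope [(s - 3/2)^2 + 11/4]; at [lam = 9] it is [6 s^2 - 28 s + 49 > 0]. The other
    uses of [q1] reduce to [lam = 9] in the same way. *)
Lemma K4_final lam s t : 9 <= lam -> 0 <= 2 * s - 5 -> lam * s - 4 - 3 * s <= t ->
  lam * (2 * s - 5) < (s - 1) * t.
Proof.
move=> l9 hs ht.
have k1 : (s - 1) * (lam * s - 4 - 3 * s) <= (s - 1) * t by apply: ler_wpM2l => //; lra.
apply: lt_le_trans k1.
have q1 : 0 <= (lam - 9) * ((s - 3 / 2) ^+ 2 + 11 / 4).
  by apply: mulr_ge0; [lra | have := sqr_ge0 (s - 3 / 2); lra].
have := sqr_ge0 (s - 7 / 3); lra.
Qed.

(** The ends of the chord are [x1] and [x3]; only [x2] and [x4] may be seen together. The weights 2,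
    1, 2, 1 are the coefficients of the entries in [eta]. *)
Lemma K4e_pointwise (x1 x2 x3 x4 : R) r1 r2 r3 r4 :
  0 <= x1 <= 1 -> 0 <= x2 <= 1 -> 0 <= x3 <= 1 -> 0 <= x4 <= 1 ->
  0 <= 2 * (x1 + x3) + (x2 + x4) - 4 ->
  ~~ (r1 && r2) -> ~~ (r1 && r3) -> ~~ (r1 && r4) -> ~~ (r3 && r2) -> ~~ (r3 && r4) ->
  (x1 + x2 + x3 + x4 - 1) / 2 * (2 * r1%:R + r2%:R + 2 * r3%:R + r4%:R) <=
  (r1%:R + (r2%:R + (r3%:R + (r4%:R + 0)))) *
  ((1 - r1%:R) * x1 + ((1 - r2%:R) * x2 + ((1 - r3%:R) * x3 + ((1 - r4%:R) * x4 + 0)))).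
Proof. by case: r1; case: r2; case: r3; case: r4 => //= *; lra. Qed.

Lemma K4e_final lam (p q t : R) : 9 <= lam -> 0 <= p <= 2 -> 0 <= q <= 2 ->
  0 <= 2 * p + q - 4 -> lam * (2 * p + q) - 6 - 4 * (p + q) <= t ->
  lam * (2 * p + q - 4) < (p + q - 1) / 2 * t.
Proof.
move=> l9 hp hq h ht.
have k1 : (p + q - 1) / 2 * (lam * (2 * p + q) - 6 - 4 * (p + q)) <= (p + q - 1) / 2 * t.
  by apply: ler_wpM2l => //; lra.
apply: lt_le_trans k1.
have q1 : 0 <= (lam - 9) * ((p + q - 1) * (2 * p + q) - 2 * (2 * p + q - 4)).
  by apply: mulr_ge0; [lra | nra].
nra.
Qed.

Lemma C4_pointwise (x1 x2 x3 x4 : R) r1 r2 r3 r4 :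
  0 <= x1 <= 1 -> 0 <= x2 <= 1 -> 0 <= x3 <= 1 -> 0 <= x4 <= 1 ->
  ~~ [|| [&& r1, r2 & r3], [&& r1, r2 & r4], [&& r1, r3 & r4] | [&& r2, r3 & r4]] ->
  (x1 + x2 + x3 + x4 - 2) * (r1%:R + (r2%:R + (r3%:R + (r4%:R + 0)))) <=
  (r1%:R + (r2%:R + (r3%:R + (r4%:R + 0)))) *
  ((1 - r1%:R) * x1 + ((1 - r2%:R) * x2 + ((1 - r3%:R) * x3 + ((1 - r4%:R) * x4 + 0)))).
Proof. by case: r1; case: r2; case: r3; case: r4 => //= *; lra. Qed.

Lemma C4_final lam s t : 9 <= lam -> 0 <= s - 3 <= 1 -> lam * s - 4 - 2 * s <= t ->
  lam * (s - 3) < (s - 2) * (t - 4).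
Proof.
move=> l9 hs ht.
have k1 : (s - 2) * (lam * s - 8 - 2 * s) <= (s - 2) * (t - 4) by apply: ler_wpM2l; lra.
apply: lt_le_trans k1.
have q1 : 0 <= (lam - 9) * ((s - 3 / 2) ^+ 2 + 3 / 4).
  by apply: mulr_ge0; [lra | have := sqr_ge0 (s - 3 / 2); lra].
have := mulr_ge0 (_ : 0 <= s - 3) (_ : 0 <= 4 - s); nra.
Qed.

(** For a triangle seen entirely by one vertex of [B]: every other vertex of [B] sees at most one of
    its corners. *)
Lemma C3_pointwise_single (x1 x2 x3 : R) r1 r2 r3 :
  x1 <= 1 -> x2 <= 1 -> x3 <= 1 ->
  ~~ (r1 && r2) -> ~~ (r1 && r3) -> ~~ (r2 && r3) ->
  (x1 + x2 + x3 - 1) * (r1%:R + (r2%:R + (r3%:R + 0))) <=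
  (r1%:R + (r2%:R + (r3%:R + 0))) *
  ((1 - r1%:R) * x1 + ((1 - r2%:R) * x2 + ((1 - r3%:R) * x3 + 0))).
Proof. by case: r1; case: r2; case: r3 => //= *; lra. Qed.

Lemma C3_final_single lam s t : 9 <= lam -> 0 <= s - 2 -> lam * s - 3 - 2 * s <= t ->
  lam * (s - 2) < (s - 1) * (t - 3).
Proof.
move=> l9 hs ht.
have k1 : (s - 1) * (lam * s - 6 - 2 * s) <= (s - 1) * (t - 3) by apply: ler_wpM2l; lra.
apply: lt_le_trans k1.
have q1 : 0 <= (lam - 9) * ((s - 1) ^+ 2 + 1).
  by apply: mulr_ge0; [lra | have := sqr_ge0 (s - 1); lra].
have := sqr_ge0 (s - 2); nra.
Qed.

Lemma C3_pointwise (x1 x2 x3 k : R) r1 r2 r3 :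
  k <= x1 <= 1 -> k <= x2 <= 1 -> k <= x3 <= 1 -> 0 <= k -> ~~ [&& r1, r2 & r3] ->
  k * (r1%:R + (r2%:R + (r3%:R + 0))) <=
  (r1%:R + (r2%:R + (r3%:R + 0))) *
  ((1 - r1%:R) * x1 + ((1 - r2%:R) * x2 + ((1 - r3%:R) * x3 + 0))).
Proof. by case: r1; case: r2; case: r3 => //= *; lra. Qed.

(** [1 <= lam * k] makes [k] positive and [s >= 2] forces [t > lam], so the inequality is strict
    even when [1 + eta = s - 2] vanishes. *)
Lemma C3_final lam s t k : 9 <= lam -> 0 <= s - 2 -> s - 2 <= k -> 1 <= lam * k ->
  lam * s - 3 - 2 * s <= t -> lam * (s - 2) < k * t.
Proof.
move=> l9 hs hk lk ht.
have k0 : 0 < k by nra.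
have t0 : lam < t by nra.
apply: (@le_lt_trans _ _ (lam * k)); first by apply: ler_wpM2l; lra.
by rewrite mulrC ltr_pM2l.
Qed.

(** The third vertex carries the pendants. A vertex seeing it and one other has degree 2 and misses
    the remaining one, whence the bounds [2 * x1] and [2 * x2]. *)
Lemma C3p_pointwise (x1 x2 x3 k : R) r1 r2 r3 :
  0 <= x1 -> 0 <= x2 -> 0 <= x3 -> k <= x3 -> k <= 2 * x1 -> k <= 2 * x2 ->
  ~~ [&& r1, r2 & r3] ->
  k * (r1%:R + r2%:R) <=
  (r1%:R + (r2%:R + (r3%:R + 0))) *
  ((1 - r1%:R) * x1 + ((1 - r2%:R) * x2 + ((1 - r3%:R) * x3 + 0))).
Proof. by case: r1; case: r2; case: r3 => //= *; lra. Qed.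

Lemma C3p_final lam s t k : 9 <= lam -> 0 <= s <= 1 ->
  2 * k = 1 + s \/ 2 * s <= k /\ 3 <= lam * k ->
  (lam - 1) * (1 + s) - 4 <= t -> lam * s < k * t.
Proof.
move=> l9 hs hk ht; have t0 : 0 <= t by nra.
case: hk => [hk|[hk lk]].
  have -> : k = (1 + s) / 2 by lra.
  have k1 : (1 + s) / 2 * ((lam - 1) * (1 + s) - 4) <= (1 + s) / 2 * t.
    by apply: ler_wpM2l; lra.
  apply: lt_le_trans k1.
  have q1 : 0 <= (lam - 9) * (1 + s ^+ 2).
    by apply: mulr_ge0; [lra | have := sqr_ge0 s; lra].
  have := sqr_ge0 (s - 3 / 8); lra.
have k0 : 0 < k by nra.
(* For small [s], [3 <= lam * k] and [3 * t > lam] suffice; otherwise [t > lam / 2] combines with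
   [2 * s <= k]. *)
have [ls|ls] := lerP (lam * s) 1.
  apply: (le_lt_trans ls).
  have : lam * 1 < lam * (k * t); last by rewrite ltr_pM2l //; lra.
  have : 3 * t <= lam * k * t by apply: ler_wpM2r.
  nra.
have s0 : 0 < s by nra.
have t1 : lam < 2 * t by nra.
apply: (@lt_le_trans _ _ (2 * s * t)); last by apply: ler_wpM2r.
nra.
Qed.
End Numeric.

(** * The link of a vertex of maximum weight *)

Lemma fan_contains_F6 (T : finType) (e : rel T) h p1 p2 p3 p4 p5 :
  symmetric e -> irreflexive e -> F6_free e ->
  uniq [:: p1; p2; p3; p4; p5] -> all (e h) [:: p1; p2; p3; p4; p5] ->
  path e p1 [:: p2; p3; p4; p5] -> False.
Proof.
move=> es ei free up hp pp; apply: free.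
pose s := [:: p1; p2; p3; p4; p5].
have hs (i : 'I_5) : e h (nth h s i) by apply: (allP hp); apply: mem_nth.
have adj (i : 'I_5) : (i.+1 < 5)%N -> e (nth h s i) (nth h s i.+1).
  move: pp => /= /and5P[e1 e2 e3 e4 _].
  by case: i => [] [|[|[|[|[|i]]]]].
exists (fun z : ('I_1 + 'I_5)%type => match z with inl _ => h | inr i => nth h s i end); split.
  have hN (i : 'I_5) : h <> nth h s i by move=> hE; have := hs i; rewrite -hE ei.
  move=> [i|i] [j|j] //=.
  - by move=> _; congr inl; apply: val_inj; case: i j => [] [|//] ? [] [|//].
  - by move/hN.
  - by move/esym/hN.
  - by move=> /eqP; rewrite nth_uniq // => /eqP ij; congr inr; apply: val_inj.
move=> [i|i] [j|j] //=; rewrite ?[e (nth _ _ _) h]es //.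
case/orP => /eqP ij; last rewrite es; rewrite -ij; apply: adj; rewrite ij; exact: ltn_ord.
Qed.

Section Link.
Variables (R : realFieldType) (T : finType) (e : rel T).
Hypotheses (es : symmetric e) (ei : irreflexive e) (free : F6_free e).
Variables (x : T -> R) (lam : R) (u : T).
Hypotheses (x_ge0 : forall v, 0 <= x v) (x_le1 : forall v, x v <= 1) (xu : x u = 1).
Hypothesis eig : forall v, \sum_(w | e v w) x w = lam * x v.
Hypothesis lam9 : 9 <= lam.

Let A := [set w | e u w].
Let B := [set w | (w != u) && ~~ e u w].
Let adj v w : R := (e v w)%:R.
Implicit Types S C : {set T}.
Let deg (S : {set T}) v : R := \sum_(w in S) adj v w.
Let miss (S : {set T}) v : R := \sum_(w in S) (1 - adj v w) * x w.
Let eta (S : {set T}) : R := \sum_(w in S) ((deg A w - 1) * x w - deg A w / 2).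
Let Phi (S : {set T}) : R := \sum_(b in B) Num.min (deg S b) (lam / 2) * miss S b.

Lemma adjC v w : adj v w = adj w v. Proof. by rewrite /adj es. Qed.
Lemma adj_ge0 v w : 0 <= adj v w. Proof. exact: ler0n. Qed.
Lemma adj_le1 v w : adj v w <= 1. Proof. by rewrite /adj; case: (e _ _). Qed.

Lemma sum_split (F : T -> R) :
  \sum_w F w = F u + \sum_(w in A) F w + \sum_(w in B) F w.
Proof.
rewrite (bigD1 u) //= -addrA; congr (_ + _).
rewrite (bigID (e u)) /=; congr (_ + _); apply: eq_bigl => w; rewrite inE //.
by case: eqVneq => [->|]; rewrite ?ei.
Qed.

Lemma eigE v : lam * x v = \sum_w adj v w * x w.
Proof.
rewrite -eig big_mkcond /=; apply: eq_bigr => w _.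
by rewrite /adj; case: (e _ _); rewrite ?mul1r ?mul0r.
Qed.

Lemma adjuA w : w \in A -> adj u w = 1. Proof. by rewrite inE /adj => ->. Qed.
Lemma adjuB w : w \in B -> adj u w = 0.
Proof. by rewrite inE /adj => /andP[_ /negPf ->]. Qed.
Lemma adjuu : adj u u = 0. Proof. by rewrite /adj ei. Qed.

Lemma sum_adju (F : T -> R) : \sum_w adj u w * F w = \sum_(w in A) F w.
Proof.
rewrite sum_split adjuu mul0r add0r [X in _ + X]big1 ?addr0 => [|w wB].
  by apply: eq_bigr => w wA; rewrite adjuA // mul1r.
by rewrite adjuB // mul0r.
Qed.

Lemma sumA_x : \sum_(w in A) x w = lam.
Proof. by rewrite -sum_adju -eigE xu mulr1. Qed.

Lemma eigA v : v \in A ->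
  lam * x v = 1 + \sum_(w in A) adj v w * x w + \sum_(b in B) adj v b * x b.
Proof. by move=> vA; rewrite eigE sum_split adjC adjuA // xu mulr1. Qed.

Lemma eigB v : v \in B ->
  lam * x v = \sum_(w in A) adj v w * x w + \sum_(b in B) adj v b * x b.
Proof. by move=> vA; rewrite eigE sum_split adjC adjuB // mul0r add0r. Qed.

Lemma degA_sum (F : T -> R) (S S' : {set T}) :
  \sum_(v in S') \sum_(w in S) adj v w * F w = \sum_(w in S) deg S' w * F w.
Proof.
rewrite exchange_big /=; apply: eq_bigr => w _; rewrite mulr_suml.
by apply: eq_bigr => v _; rewrite adjC.
Qed.

(** * The spectral identity, the loss and the functional [Phi] *)

Let loss : R := \sum_(b in B) (deg A b * (1 - x b) + deg B b / 2).

(** The entries on [A] sum to [lam]; multiplying by [lam] and expanding with the eigenvalue equation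
    at each vertex of [A] gives [lam ^+ 2]. Splitting the degree sum over [u], [A] and [B] gives
    twice the number of edges. *)
Lemma spectral_identity :
  lam ^+ 2 - lam - ((\sum_v \sum_w adj v w) / 2 - 1) = 1 + eta A - loss.
Proof.
have l2 : lam ^+ 2 = \sum_(w in A) 1 + \sum_(w in A) deg A w * x w + \sum_(b in B) deg A b * x b.
  rewrite expr2 -[X in _ * X]sumA_x mulr_sumr (eq_bigr _ (fun v => @eigA v)) !big_split /=.
  by rewrite !degA_sum.
have dsum v : \sum_w adj v w = adj v u + deg A v + deg B v by rewrite sum_split.
have m2 : \sum_v \sum_w adj v w = 2 * \sum_(w in A) 1 + \sum_(w in A) deg A w
     + 2 * (\sum_(b in B) deg A b) + \sum_(b in B) deg B b.
  rewrite sum_split; under eq_bigr => w _ do rewrite -[adj u w]mulr1.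
  rewrite sum_adju.
  under [X in _ + X + _]eq_bigr => w wA do rewrite dsum adjC adjuA //.
  under [X in _ + _ + X]eq_bigr => w wA do rewrite dsum adjC adjuB //.
  rewrite !big_split /= [X in _ + (X + _ + _)]big1 //.
  have -> : \sum_(i in A) deg B i = \sum_(i in B) deg A i.
    by rewrite /deg exchange_big; apply: eq_bigr => i _; apply: eq_bigr => j _; exact: adjC.
  ring.
have etaE : eta A = \sum_(w in A) deg A w * x w - lam - (\sum_(w in A) deg A w) / 2.
  rewrite -sumA_x /eta mulr_suml -!sumrB; apply: eq_bigr => w _; ring.
have lossE : loss = \sum_(b in B) deg A b - \sum_(b in B) deg A b * x b
    + (\sum_(b in B) deg B b) / 2.
  rewrite /loss mulr_suml -sumrB -big_split; apply: eq_bigr => w _ /=; ring.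
by rewrite l2 m2 etaE lossE; field.
Qed.

Lemma lam_x_ge1 v : v \in A -> 1 <= lam * x v.
Proof.
move=> vA; rewrite (eigA vA) -addrA lerDl.
by apply: addr_ge0; apply: sumr_ge0 => w _; apply: mulr_ge0; rewrite ?adj_ge0.
Qed.

Lemma deg_ge0 S v : 0 <= deg S v.
Proof. by apply: sumr_ge0 => w _; exact: adj_ge0. Qed.

Lemma missF_ge0 v w : 0 <= (1 - adj v w) * x w.
Proof. by apply: mulr_ge0; rewrite ?subr_ge0 ?adj_le1. Qed.

Lemma miss_ge0 S v : 0 <= miss S v.
Proof. by apply: sumr_ge0 => w _; exact: missF_ge0. Qed.

Lemma min_ge0 S v : 0 <= Num.min (deg S v) (lam / 2).
Proof. by rewrite le_min deg_ge0 divr_ge0 ?(le_trans _ lam9). Qed.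

Lemma Phi_ge0 S : 0 <= Phi S.
Proof. by apply: sumr_ge0 => b _; rewrite mulr_ge0 ?min_ge0 ?miss_ge0. Qed.

Lemma sum_setU (S1 S2 : {set T}) (F : T -> R) : [disjoint S1 & S2] ->
  \sum_(w in S1 :|: S2) F w = \sum_(w in S1) F w + \sum_(w in S2) F w.
Proof. by move=> dis; rewrite -bigU //=; apply: eq_bigl => w; rewrite !inE. Qed.

(** For each [b] the missed weight is additive and the capped degree is monotone, so the product
    over the union dominates the sum of the two products. *)
Lemma Phi_superadd (S1 S2 : {set T}) : [disjoint S1 & S2] -> Phi S1 + Phi S2 <= Phi (S1 :|: S2).
Proof.
move=> dis; rewrite /Phi -big_split /=; apply: ler_sum => b _.
have -> : deg (S1 :|: S2) b = deg S1 b + deg S2 b by exact: sum_setU.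
have -> : miss (S1 :|: S2) b = miss S1 b + miss S2 b by exact: sum_setU.
have := deg_ge0 S1 b; have := deg_ge0 S2 b; have := miss_ge0 S1 b; have := miss_ge0 S2 b.
set d1 := deg S1 b; set d2 := deg S2 b => m2 m1 p2 p1.
have h1 : Num.min d1 (lam / 2) <= Num.min (d1 + d2) (lam / 2).
  by rewrite le_min !ge_min lexx orbT andbT lerDl p2.
have h2 : Num.min d2 (lam / 2) <= Num.min (d1 + d2) (lam / 2).
  by rewrite le_min !ge_min lexx orbT andbT lerDr p1.
by rewrite mulrDr lerD // ler_wpM2r.
Qed.

Lemma eta_add (S1 S2 : {set T}) : [disjoint S1 & S2] -> eta (S1 :|: S2) = eta S1 + eta S2.
Proof. exact: sum_setU. Qed.

Lemma Phi_mono (S1 S2 : {set T}) : S1 \subset S2 -> Phi S1 <= Phi S2.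
Proof.
move=> s12; rewrite -(setID S2 S1) (setIidPr s12).
apply: le_trans (Phi_superadd _); first by rewrite lerDl Phi_ge0.
by rewrite disjoints_subset setCD subsetUr.
Qed.

(* The cap [lam / 2] in [Phi] lets the term [deg B b / 2] of [loss] absorb the
   weight that [b] receives from inside [B]. *)
Lemma Phi_le_loss : Phi A <= lam * loss.
Proof.
rewrite /loss mulr_sumr; apply: ler_sum => b bB.
have xb := x_le1 b.
have h : miss A b - deg B b <= lam * (1 - x b).
  have -> : miss A b = lam - \sum_(w in A) adj b w * x w.
    by rewrite -sumA_x -sumrB; apply: eq_bigr => w _; ring.
  rewrite mulrBr mulr1 (eigB bB).
  have : \sum_(b0 in B) adj b b0 * x b0 <= deg B b.
    by apply: ler_sum => w _; rewrite ler_piMr ?adj_ge0.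
  lra.
have := min_ge0 A b; have mB := deg_ge0 B b; have mM := miss_ge0 A b.
have m1 : Num.min (deg A b) (lam / 2) <= deg A b by rewrite ge_min lexx.
have m2 : Num.min (deg A b) (lam / 2) <= lam / 2 by rewrite ge_min lexx orbT.
move: m1 m2; set m := Num.min _ _ => m1 m2 m0.
have k1 : m * (miss A b - deg B b) <= m * (lam * (1 - x b)) by rewrite ler_wpM2l.
have k2 : m * (lam * (1 - x b)) <= deg A b * (lam * (1 - x b)).
  by rewrite ler_wpM2r // mulr_ge0 //; lra.
have k3 : m * deg B b <= lam / 2 * deg B b by rewrite ler_wpM2r.
lra.
Qed.

(** Entries on [B] are at most 1, so the weight that [v] still needs from [B] bounds its number of
    neighbours there from below. *)
Lemma countB v : v \in A ->
  lam * x v - 1 - \sum_(w in A) adj v w * x w <= \sum_(b in B) adj b v.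
Proof.
move=> vA; rewrite (eigA vA).
have : \sum_(b in B) adj v b * x b <= \sum_(b in B) adj b v.
  by apply: ler_sum => b _; rewrite adjC ler_piMr ?adj_ge0.
lra.
Qed.

(** A union of connected components of the link [G[A]]. *)
Definition closedA (S : {set T}) :=
  S \subset A /\ forall v w, v \in S -> e v w -> w \in A -> w \in S.

Lemma closedA_sum (S : {set T}) v (F : T -> R) : closedA S -> v \in S ->
  \sum_(w in A) adj v w * F w = \sum_(w in S) adj v w * F w.
Proof.
move=> [SA cl] vS; rewrite (big_setID S) /= (setIidPr SA) [X in _ + X]big1 ?addr0 //.
move=> w; rewrite inE => /andP[wS wA].
rewrite /adj; case: (boolP (e v w)) => [vw|_]; last by rewrite mul0r.
by rewrite (cl v w) in wS.
Qed.

Lemma closedA_deg (S : {set T}) v : closedA S -> v \in S -> deg A v = deg S v.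
Proof.
move=> cS vS; rewrite /deg (eq_bigr (fun w => adj v w * 1)) => [|w _]; last by rewrite mulr1.
by rewrite (closedA_sum (fun=> 1) cS vS); apply: eq_bigr => w _; rewrite mulr1.
Qed.

Lemma closedAD S C : closedA S -> closedA C -> closedA (S :\: C).
Proof.
move=> [SA clS] [CA clC]; split; first exact: subset_trans (subsetDl _ _) SA.
move=> v w /setDP[vS vC] vw wA; apply/setDP; split; first exact: clS vw wA.
by apply: contra vC => wC; apply: (clC w v) => //; [rewrite es | exact: (subsetP SA)].
Qed.

Lemma sum_seq (s : seq T) (F : T -> R) : uniq s ->
  \sum_(w in [set w in s]) F w = \sum_(w <- s) F w.
Proof. by move=> us; rewrite (eq_bigl (mem s)) ?big_uniq // => w; rewrite inE. Qed.

(** A vertex has at most four neighbours in [s] and [lam / 2 > 4], so the cap in [Phi] is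
    inactive. *)
Lemma Phi_core (s : seq T) (C : {set T}) : uniq s -> (size s <= 4)%N -> {subset s <= C} ->
  \sum_(b in B) (\sum_(w <- s) adj b w) * (\sum_(w <- s) (1 - adj b w) * x w) <= Phi C.
Proof.
move=> us ss sC; apply: le_trans (@Phi_mono [set w in s] C _); last first.
  by apply/subsetP => w; rewrite inE; exact: sC.
apply: ler_sum => b _; rewrite /deg /miss !sum_seq //.
suff /min_l -> : \sum_(w <- s) adj b w <= lam / 2 by [].
have l4 : 4 <= lam / 2 by have := lam9; lra.
apply: le_trans l4.
apply: (@le_trans _ _ (\sum_(w <- s) 1)); first by apply: ler_sum => w _; exact: adj_le1.
by rewrite big_const_seq count_predT iter_addr addr0 (ler_nat R _ 4).
Qed.

(** * Forbidden fans *)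

Lemma A_neq_u v : v \in A -> ((v == u) = false) * ((u == v) = false).
Proof.
by rewrite inE [u == v]eq_sym => uv; split; apply/eqP => vu; rewrite vu ei in uv.
Qed.
Lemma B_neq_u v : v \in B -> ((v == u) = false) * ((u == v) = false).
Proof. by rewrite inE [u == v]eq_sym => /andP[/negPf]. Qed.
Lemma A_neq_B v b : v \in A -> b \in B -> ((v == b) = false) * ((b == v) = false).
Proof.
rewrite !inE [b == v]eq_sym => uv /andP[_ ub].
by split; apply/eqP => vb; rewrite vb (negPf ub) in uv.
Qed.
Lemma eAu v : v \in A -> e v u. Proof. by rewrite inE es. Qed.
Lemma euA v : v \in A -> e u v. Proof. by rewrite inE. Qed.

Let nofan h p1 p2 p3 p4 p5 := @fan_contains_F6 T e h p1 p2 p3 p4 p5 es ei free.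

(* The fan lemmas are named after the order in which [u], vertices of [A]
   ([p, q, r, l]) and vertices of [B] ([b]) occur along the path of the fan. *)
Lemma no_P5 p1 p2 p3 p4 p5 : {subset [:: p1; p2; p3; p4; p5] <= A} ->
  uniq [:: p1; p2; p3; p4; p5] -> path e p1 [:: p2; p3; p4; p5] -> False.
Proof. by move=> sA up pp; apply: (nofan (h := u)) up _ pp; apply/allP => w /sA/euA. Qed.

Lemma no_fan_bpqur h b p q r : h \in A -> p \in A -> q \in A -> r \in A -> b \in B ->
  uniq [:: p; q; r] -> e h b -> e h p -> e h q -> e h r -> e b p -> e p q -> False.
Proof.
move=> hA pA qA rA bB; rewrite /= !inE !negb_or andbT => /andP[/andP[npq npr] nqr].
move=> hb hp hq hr bp pq.
apply: (@nofan h b p q u r).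
- rewrite /= !inE !negb_or !(A_neq_B pA bB, A_neq_B qA bB, A_neq_B rA bB).
  by rewrite !(A_neq_u pA, A_neq_u qA, A_neq_u rA, B_neq_u bB) npq npr nqr.
- by rewrite /= hb hp hq hr eAu.
- by rewrite /= bp pq eAu // euA.
Qed.

Lemma no_fan_upbqb h b b' p q : h \in A -> p \in A -> q \in A -> b \in B -> b' \in B ->
  p != q -> b != b' -> e h p -> e h q -> e h b -> e h b' ->
  e p b -> e b q -> e q b' -> False.
Proof.
move=> hA pA qA bB b'B pq bb hp hq hb hb' pb bq qb'.
apply: (@nofan h u p b q b').
- rewrite /= !inE !negb_or !(A_neq_B pA bB, A_neq_B qA bB, A_neq_B pA b'B, A_neq_B qA b'B).
  by rewrite !(A_neq_u pA, A_neq_u qA, B_neq_u bB, B_neq_u b'B) pq bb.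
- by rewrite /= hb hp hq hb' eAu.
- by rewrite /= pb bq qb' euA.
Qed.

Lemma no_fan_bpuqb h b b' p q : h \in A -> p \in A -> q \in A -> b \in B -> b' \in B ->
  p != q -> b != b' -> e h p -> e h q -> e h b -> e h b' ->
  e b' p -> e q b -> False.
Proof.
move=> hA pA qA bB b'B pq bb hp hq hb hb' b'p qb.
apply: (@nofan h b' p u q b).
- rewrite /= !inE !negb_or !(A_neq_B pA bB, A_neq_B qA bB, A_neq_B pA b'B, A_neq_B qA b'B).
  by rewrite !(A_neq_u pA, A_neq_u qA, B_neq_u bB, B_neq_u b'B) pq [b' == b]eq_sym bb.
- by rewrite /= hb hp hq hb' eAu.
- by rewrite /= b'p qb eAu // euA.
Qed.

Lemma no_fan_lupbq h b l p q : h \in A -> l \in A -> p \in A -> q \in A -> b \in B ->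
  uniq [:: l; p; q] -> e h l -> e h p -> e h q -> e h b -> e p b -> e b q -> False.
Proof.
move=> hA lA pA qA bB; rewrite /= !inE !negb_or andbT => /andP[/andP[lp lq] pq] hl hp hq hb pb bq.
apply: (@nofan h l u p b q).
- rewrite /= !inE !negb_or !(A_neq_B lA bB, A_neq_B pA bB, A_neq_B qA bB).
  by rewrite !(A_neq_u lA, A_neq_u pA, A_neq_u qA, B_neq_u bB) lp lq pq.
- by rewrite /= hb hp hq hl eAu.
- by rewrite /= pb bq eAu // euA.
Qed.

Lemma adj1 v w : e v w -> (adj v w = 1) * (adj w v = 1).
Proof. by move=> vw; rewrite [adj w v]adjC /adj vw. Qed.
Lemma adj0 v w : ~~ e v w -> (adj v w = 0) * (adj w v = 0).
Proof. by move=> /negPf vw; rewrite [adj w v]adjC /adj vw. Qed.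
Lemma adjvv v : adj v v = 0. Proof. by rewrite /adj ei. Qed.

Lemma closed_seq_deg (s : seq T) v : closedA [set w in s] -> uniq s -> v \in s ->
  deg A v = \sum_(w <- s) adj v w.
Proof. by move=> cl us vs; rewrite (closedA_deg cl) ?inE // /deg sum_seq. Qed.

Lemma closed_seq_countB (s : seq T) v : closedA [set w in s] -> uniq s -> v \in s ->
  lam * x v - 1 - \sum_(w <- s) adj v w * x w <= \sum_(b in B) adj b v.
Proof.
move=> cl us vs; rewrite -sum_seq // -(closedA_sum x cl) ?inE //; apply: countB.
by apply: (subsetP cl.1); rewrite inE.
Qed.

Lemma closed_seq_eta (s : seq T) : closedA [set w in s] -> uniq s ->
  eta [set w in s] =
  \sum_(w <- s) ((\sum_(z <- s) adj w z - 1) * x w - (\sum_(z <- s) adj w z) / 2).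
Proof.
move=> cl us; rewrite /eta sum_seq //; apply: eq_big_seq => w ws.
by rewrite (closed_seq_deg cl us ws).
Qed.

(** A strong component pays for its own [eta] and also for the constant 1 of [spectral_identity]. *)
Let strong C := lam * (1 + eta C) < Phi C.

Lemma strong_of_eta C : 1 + eta C < 0 -> strong C.
Proof.
move=> h; apply: lt_le_trans (Phi_ge0 C); rewrite pmulr_rlt0 //.
by have := lam9; lra.
Qed.

Let beta (s : seq T) b := (\sum_(w <- s) adj b w) * (\sum_(w <- s) (1 - adj b w) * x w).

Lemma beta_ge0 s b : 0 <= beta s b.
Proof. by apply: mulr_ge0; apply: sumr_ge0 => w _; rewrite ?adj_ge0 ?missF_ge0. Qed.

Lemma Phi_lower s C k : uniq s -> (size s <= 4)%N -> {subset s <= C} ->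
  (forall b, b \in B -> k * (\sum_(w <- s) adj b w) <= beta s b) ->
  k * (\sum_(w <- s) \sum_(b in B) adj b w) <= Phi C.
Proof.
move=> us ss sC h; apply: le_trans (Phi_core us ss sC).
by rewrite exchange_big mulr_sumr; apply: ler_sum => b /h.
Qed.

(* A C4 or a triangle may have one neighbour in [B] that sees almost all of it. *)
Lemma Phi_lower_but1 s C k b0 : uniq s -> (size s <= 4)%N -> {subset s <= C} -> 0 <= k ->
  (forall b, b \in B -> b != b0 -> k * (\sum_(w <- s) adj b w) <= beta s b) ->
  k * (\sum_(w <- s) \sum_(b in B) adj b w - (size s)%:R) <= Phi C.
Proof.
move=> us ss sC k0 h; apply: le_trans (Phi_core us ss sC).
pose D b : R := if b == b0 then (size s)%:R else 0.
have DB : \sum_(b in B) D b <= (size s)%:R.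
  have [b0B|b0B] := boolP (b0 \in B).
    by rewrite (bigD1 b0) //= /D eqxx big1 ?addr0 // => b /andP[_ /negPf ->].
  rewrite big1 ?ler0n // => b bB; rewrite /D; case: eqP => // bb.
  by case/negP: b0B; rewrite -bb.
apply: (@le_trans _ _ (\sum_(b in B) k * (\sum_(w <- s) adj b w - D b))).
  by rewrite -mulr_sumr ler_wpM2l // sumrB [X in _ <= X - _]exchange_big lerD2l lerN2.
apply: ler_sum => b bB; rewrite /D; case: eqVneq => [_|bb]; last by rewrite subr0; exact: h.
apply: le_trans (beta_ge0 s b); rewrite mulr_ge0_le0 // subr_le0.
apply: le_trans (_ : \sum_(w <- s) 1 <= _); first by apply: ler_sum => w _; exact: adj_le1.
by rewrite big_const_seq count_predT iter_addr addr0.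
Qed.

Lemma Phi_lower_fun s C (g : T -> R) : uniq s -> (size s <= 4)%N -> {subset s <= C} ->
  (forall b, b \in B -> g b <= beta s b) -> \sum_(b in B) g b <= Phi C.
Proof.
by move=> us ss sC h; apply: le_trans (Phi_core us ss sC); apply: ler_sum => b /h.
Qed.

Lemma nand (v w : bool) : (v -> w -> False) -> ~~ (v && w).
Proof. by move=> h; apply/negP => /andP[/h]. Qed.

(** * Components on a 4-cycle *)

Let cnt v := \sum_(b in B) adj b v.

(** The diagonals enter only through [adj a c] and [adj b d], so one computation serves the cycle
    with zero, one or two chords. *)
Lemma quad_data a b c d : let s := [:: a; b; c; d] in
  closedA [set w in s] -> uniq s -> e a b -> e b c -> e c d -> e d a ->
  [/\ [/\ a \in A, b \in A, c \in A & d \in A],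
   1 + eta [set w in s] = (1 + adj a c) * (x a + x c) + (1 + adj b d) * (x b + x d)
     - 3 - adj a c - adj b d &
   [/\ lam * x a - 1 - x b - x d - adj a c * x c <= cnt a,
       lam * x b - 1 - x a - x c - adj b d * x d <= cnt b,
       lam * x c - 1 - x b - x d - adj a c * x a <= cnt c &
       lam * x d - 1 - x a - x c - adj b d * x b <= cnt d]].
Proof.
move=> s cl us ab bc cd da.
have sA v : v \in s -> v \in A by move=> vs; apply: (subsetP cl.1); rewrite inE.
have [as_ bs cs ds] : [/\ a \in s, b \in s, c \in s & d \in s].
  by rewrite !inE !eqxx ?orbT.
have etaE := closed_seq_eta cl us.
have Ra := closed_seq_countB cl us as_; have Rb := closed_seq_countB cl us bs.
have Rc := closed_seq_countB cl us cs; have Rd := closed_seq_countB cl us ds.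
have adjE := (adj1 ab, adj1 bc, adj1 cd, adj1 da, adjC c a, adjC d b, adjvv).
move: etaE Ra Rb Rc Rd; rewrite /s !big_cons !big_nil !adjE -!/(cnt _) => etaE Ra Rb Rc Rd.
split; first by rewrite !sA.
  by rewrite etaE; field.
by split; lra.
Qed.

(** If [w] in [B] saw two vertices [p] and [q], then [p] would be the centre of a fan along
    [w, q, r, u, t]. So each vertex of [B] sees at most one vertex. *)
Lemma strong_K4 a b c d : let s := [:: a; b; c; d] in
  closedA [set w in s] -> uniq s ->
  e a b -> e b c -> e c d -> e d a -> e a c -> e b d -> strong [set w in s].
Proof.
move=> s cl us ab bc cd da ac bd.
have [[aA bA cA dA]] := quad_data cl us ab bc cd da.
rewrite !(adj1 ac, adj1 bd) => etaE [Ra Rb Rc Rd].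
have [h|h] := ltrP (1 + eta [set w in s]) 0; first exact: strong_of_eta.
have := us; rewrite /= !inE !negb_or andbT => /and3P[/and3P[nab nac nad] /andP[nbc nbd] ncd].
have key : (x a + x b + x c + x d - 1) *
    (\sum_(w <- s) \sum_(b in B) adj b w) <= Phi [set w in s].
  apply: Phi_lower => //; first by move=> v vs; rewrite inE.
  move=> w wB; rewrite /beta /s !big_cons !big_nil.
  have two p q r t : p \in A -> q \in A -> r \in A -> t \in A ->
    e p q -> e p r -> e p t -> e q r -> uniq [:: q; r; t] -> ~~ (e w p && e w q).
    move=> pA qA rA tA pq pr pt qr uq; apply: nand => wp wq.
    by apply: (no_fan_bpqur pA qA rA tA wB uq) => //; rewrite es.
  apply: K4_pointwise; rewrite ?x_le1 //.
  - by apply: (two a b c d) => //; rewrite 1?es //= !inE !negb_or nbc nbd ncd.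
  - by apply: (two a c b d) => //; rewrite 1?es //= !inE !negb_or eq_sym nbc ncd nbd.
  - apply: (two a d b c) => //; rewrite 1?es //=.
    by rewrite !inE !negb_or ![d == _]eq_sym nbd ncd nbc.
  - by apply: (two b c a d) => //; rewrite 1?es //= !inE !negb_or eq_sym nac ncd nad.
  - apply: (two b d a c) => //; rewrite 1?es //=.
    by rewrite !inE !negb_or ![d == _]eq_sym nad ncd nac.
  - apply: (two c d a b) => //; rewrite 1?es //=.
    by rewrite !inE !negb_or ![d == _]eq_sym nad nbd nab.
apply: lt_le_trans key; rewrite /s !big_cons !big_nil -!/(cnt _).
have -> : 1 + eta [set w in s] = 2 * (x a + x b + x c + x d) - 5 by rewrite etaE; ring.
by apply: K4_final; move: lam9 h Ra Rb Rc Rd; rewrite ?etaE; lra.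
Qed.

(** The fan used for [K_4] needs a centre with three neighbours in the link, so it exists only at
    [a] and [c]; a vertex of [B] may see both [b] and [d]. *)
Lemma strong_K4e a b c d : let s := [:: a; b; c; d] in
  closedA [set w in s] -> uniq s ->
  e a b -> e b c -> e c d -> e d a -> e a c -> ~~ e b d -> strong [set w in s].
Proof.
move=> s cl us ab bc cd da ac bd.
have [[aA bA cA dA]] := quad_data cl us ab bc cd da.
rewrite !(adj1 ac, adj0 bd) => etaE [Ra Rb Rc Rd].
have [h|h] := ltrP (1 + eta [set w in s]) 0; first exact: strong_of_eta.
have := us; rewrite /= !inE !negb_or andbT => /and3P[/and3P[nab nac nad] /andP[nbc nbd] ncd].
have xb01 v : 0 <= x v <= 1 by rewrite x_ge0 x_le1.
have key : \sum_(w in B) (x a + x b + x c + x d - 1) / 2 *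
    (2 * adj w a + adj w b + 2 * adj w c + adj w d) <= Phi [set w in s].
  apply: (Phi_lower_fun us) => //; first by move=> v vs; rewrite inE.
  move=> w wB; rewrite /beta /s !big_cons !big_nil.
  have two p q r t : p \in A -> q \in A -> r \in A -> t \in A ->
    e p q -> e p r -> e p t -> e q r -> uniq [:: q; r; t] -> ~~ (e w p && e w q).
    move=> pA qA rA tA pq pr pt qr uq; apply: nand => wp wq.
    by apply: (no_fan_bpqur pA qA rA tA wB uq) => //; rewrite es.
  apply: K4e_pointwise => //; first by move: h; rewrite etaE; lra.
  - by apply: (two a b c d) => //; rewrite 1?es //= !inE !negb_or nbc nbd ncd.
  - by apply: (two a c b d) => //; rewrite 1?es //= !inE !negb_or eq_sym nbc ncd nbd.
  - apply: (two a d c b) => //; rewrite 1?es //=.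
    by rewrite !inE !negb_or ![d == _]eq_sym [c == b]eq_sym nbd ncd nbc.
  - by apply: (two c b a d) => //; rewrite 1?es //= !inE !negb_or eq_sym nab nbd nad.
  - apply: (two c d a b) => //; rewrite 1?es //=.
    by rewrite !inE !negb_or ![d == _]eq_sym nad nbd nab.
apply: lt_le_trans key; rewrite -mulr_sumr !big_split /= -!mulr_sumr -!/(cnt _).
have -> : 1 + eta [set w in s] = 2 * (x a + x c) + (x b + x d) - 4 by rewrite etaE; ring.
have -> : x a + x b + x c + x d = (x a + x c) + (x b + x d) by ring.
have := xb01 a; have := xb01 b; have := xb01 c; have := xb01 d.
by move=> *; apply: K4e_final; move: lam9 h Ra Rb Rc Rd; rewrite ?etaE; lra.
Qed.

Lemma eC v w : e v w -> e w v. Proof. by rewrite es. Qed.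

(** The fans are centred at [a], along [u, d, w, b, w'] or its mirror image, and at [b], along
    [w', c, u, a, w]. Any three vertices of the cycle contain one of the listed pairs, so at most
    one vertex of [B] sees three of them. *)
Lemma C4_two_hubs a b c d w w' : a \in A -> b \in A -> c \in A -> d \in A ->
  w \in B -> w' \in B -> w != w' -> b != d -> c != a -> e a b -> e b c -> e d a ->
  e w a -> e w b -> e w d -> (e w' a && (e w' b || e w' d)) || (e w' b && e w' c) -> False.
Proof.
move=> aA bA cA dA wB w'B ww bd ca ab bc da wa wb wd.
have [ba ad aw bw dw] := And5 (eC ab) (eC da) (eC wa) (eC wb) (eC wd).
case/orP => [/andP[w'a /orP[w'b|w'd]]|/andP[w'b w'c]].
- have [aw' bw'] := conj (eC w'a) (eC w'b).
  by apply: (no_fan_upbqb aA dA bA wB w'B) => //; rewrite eq_sym.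
- have [aw' dw'] := conj (eC w'a) (eC w'd).
  exact: (no_fan_upbqb aA bA dA wB w'B).
- have bw' := eC w'b.
  exact: (no_fan_bpuqb bA cA aA wB w'B).
Qed.

Lemma strong_C4 a b c d : let s := [:: a; b; c; d] in
  closedA [set w in s] -> uniq s ->
  e a b -> e b c -> e c d -> e d a -> ~~ e a c -> ~~ e b d -> strong [set w in s].
Proof.
move=> s cl us ab bc cd da ac bd.
have [[aA bA cA dA]] := quad_data cl us ab bc cd da.
rewrite !(adj0 ac, adj0 bd) => etaE [Ra Rb Rc Rd].
have [h|h] := ltrP (1 + eta [set w in s]) 0; first exact: strong_of_eta.
have := us; rewrite /= !inE !negb_or andbT => /and3P[/and3P[nab nac nad] /andP[nbc nbd] ncd].
have [nca ndb] : c != a /\ d != b by rewrite eq_sym nac eq_sym.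
have xb01 v : 0 <= x v <= 1 by rewrite x_ge0 x_le1.
pose tri w := [|| [&& e w a, e w b & e w c], [&& e w a, e w b & e w d],
                  [&& e w a, e w c & e w d] | [&& e w b, e w c & e w d]].
have two w w' : w \in B -> w' \in B -> w != w' -> tri w -> ~~ tri w'.
  move=> wB w'B ww /or4P[]/and3P[h1 h2 h3]; apply/negP; rewrite /tri => h'.
  - apply: (@C4_two_hubs b c d a w w') => //.
    by move: h'; case: (e w' a); case: (e w' b); case: (e w' c); case: (e w' d).
  - apply: (@C4_two_hubs a b c d w w') => //.
    by move: h'; case: (e w' a); case: (e w' b); case: (e w' c); case: (e w' d).
  - apply: (@C4_two_hubs d a b c w w') => //.
    by move: h'; case: (e w' a); case: (e w' b); case: (e w' c); case: (e w' d).
  - apply: (@C4_two_hubs c d a b w w') => //.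
    by move: h'; case: (e w' a); case: (e w' b); case: (e w' c); case: (e w' d).
have [b0 hb0] : exists b0, forall w, w \in B -> w != b0 -> ~~ tri w.
  case: (pickP [pred w in B | tri w]) => [b0 /andP[b0B t0]|none].
    by exists b0 => w wB wb0; apply: two t0 => //; rewrite eq_sym.
  (* [u] is a dummy exception: it does not lie in [B]. *)
  by exists u => w wB _; have := none w; rewrite /= wB /= => ->.
have key : (x a + x b + x c + x d - 2) *
    (\sum_(w <- s) \sum_(b in B) adj b w - (size s)%:R) <= Phi [set w in s].
  apply: (@Phi_lower_but1 _ _ _ b0) => //.
  - by move=> v vs; rewrite inE.
  - by move: h; rewrite etaE; lra.
  move=> w wB wb0; rewrite /beta /s !big_cons !big_nil.
  by apply: C4_pointwise => //; exact: hb0.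
apply: lt_le_trans key; rewrite /s !big_cons !big_nil -!/(cnt _).
have -> : 1 + eta [set w in s] = x a + x b + x c + x d - 3 by rewrite etaE; ring.
have := xb01 a; have := xb01 b; have := xb01 c; have := xb01 d.
by move=> *; apply: C4_final; move: lam9 h Ra Rb Rc Rd; rewrite ?etaE; lra.
Qed.

Lemma strong_4cycle a b c d : let s := [:: a; b; c; d] in
  closedA [set w in s] -> uniq s -> e a b -> e b c -> e c d -> e d a -> strong [set w in s].
Proof.
move=> s cl us ab bc cd da.
have [ac|ac] := boolP (e a c); have [bd|bd] := boolP (e b d).
- exact: strong_K4.
- exact: strong_K4e.
(* The only chord is [b d]; rotating the cycle turns it into the first diagonal. *)
- have rs : [set w in s] = [set w in rot 1 s] by apply/setP => w; rewrite !in_set mem_rot.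
  rewrite rs; apply: (@strong_K4e b c d a) => //; first by rewrite -[[:: b; c; d; a]]/(rot 1 s) -rs.
    by rewrite -[[:: b; c; d; a]]/(rot 1 s) rot_uniq.
  by rewrite es.
- exact: strong_C4.
Qed.

(** * Triangle components *)

Lemma strong_C3 a b c : let s := [:: a; b; c] in
  closedA [set w in s] -> uniq s -> e a b -> e b c -> e c a -> strong [set w in s].
Proof.
move=> s cl us ab bc ca.
have sA v : v \in s -> v \in A by move=> vs; apply: (subsetP cl.1); rewrite inE.
have [as_ bs cs] : [/\ a \in s, b \in s & c \in s] by rewrite !inE !eqxx ?orbT.
have [aA bA cA] : [/\ a \in A, b \in A & c \in A] by rewrite !sA.
have etaE := closed_seq_eta cl us.
have Ra := closed_seq_countB cl us as_; have Rb := closed_seq_countB cl us bs.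
have Rc := closed_seq_countB cl us cs.
have adjE := (adj1 ab, adj1 bc, adj1 ca, adjvv).
move: etaE Ra Rb Rc; rewrite /s !big_cons !big_nil !adjE -!/(cnt _) => etaE Ra Rb Rc.
have {}etaE : 1 + eta [set w in s] = x a + x b + x c - 2 by rewrite etaE; field.
have [h|h] := ltrP (1 + eta [set w in s]) 0; first exact: strong_of_eta.
have := us; rewrite /= !inE !negb_or andbT => /andP[/andP[nab nac] nbc].
have [nba nca ncb] : [/\ b != a, c != a & c != b] by rewrite eq_sym nab eq_sym nac eq_sym.
have [ba cb ac] := And3 (eC ab) (eC bc) (eC ca).
have xb01 v : 0 <= x v <= 1 by rewrite x_ge0 x_le1.
rewrite /strong etaE; rewrite etaE in h.
have xa := xb01 a; have xb := xb01 b; have xc := xb01 c.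
have [b0 /andP[b0B /and3P[b0a b0b b0c]]|none] :=
    pickP [pred w in B | [&& e w a, e w b & e w c]].
  (* Since [b0] sees the whole triangle, another [w] seeing [p] and [q] would complete a fan at [p]
     along [u, r, b0, q, w]. *)
  have two w p q r : w \in B -> w != b0 -> p \in A -> q \in A -> r \in A -> r != q ->
      e p q -> e p r -> e b0 p -> e b0 q -> e b0 r -> ~~ (e w p && e w q).
    move=> wB wb0 pA qA rA rq pq pr b0p b0q b0r; apply: nand => wp wq.
    have [pb0 rb0 pw qw] := And4 (eC b0p) (eC b0r) (eC wp) (eC wq).
    by apply: (no_fan_upbqb pA rA qA b0B wB) => //; rewrite eq_sym.
  have key : (x a + x b + x c - 1) *
      (\sum_(w <- s) \sum_(b in B) adj b w - (size s)%:R) <= Phi [set w in s].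
    apply: (@Phi_lower_but1 _ _ _ b0) => //.
    - by move=> v vs; rewrite inE.
    - by lra.
    move=> w wB wb0; rewrite /beta /s !big_cons !big_nil.
    apply: C3_pointwise_single; rewrite ?x_le1 //.
    - exact: (@two w a b c).
    - exact: (@two w a c b).
    - exact: (@two w b c a).
  apply: lt_le_trans key; rewrite /s !big_cons !big_nil -!/(cnt _).
  by apply: C3_final_single; move: lam9 h Ra Rb Rc; lra.
have l0 : 0 < lam by have := lam9; lra.
(* Both candidates bound every entry of the triangle from below: the first because the other two
   entries are at most 1, the second because [lam * x v >= 1] on [A]. The second keeps [k]
   positive. *)
pose k := Num.max (x a + x b + x c - 2) lam^-1.
have kx v : v \in A -> lam^-1 <= x v.
  by move=> vA; rewrite -div1r ler_pdivrMr // mulrC; exact: lam_x_ge1.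
have k0 : 0 <= k by rewrite le_max invr_ge0 (ltW l0) orbT.
have key : k * (\sum_(w <- s) \sum_(b in B) adj b w) <= Phi [set w in s].
  apply: Phi_lower => //; first by move=> v vs; rewrite inE.
  move=> w wB; rewrite /beta /s !big_cons !big_nil.
  apply: C3_pointwise; rewrite ?x_le1 ?andbT ?ge_max ?kx ?andbT //; try lra.
  by have := none w; rewrite /= wB /= => ->.
apply: lt_le_trans key; rewrite /s !big_cons !big_nil -!/(cnt _).
apply: C3_final => //; first by rewrite le_max lexx.
  by rewrite -ler_pdivrMl // mulr1 le_max lexx orbT.
by move: Ra Rb Rc; lra.
Qed.

(** * Neighbourhoods in the link and triangles with pendants *)

Lemma sum_nbr (N : {set T}) v (F : T -> R) : N \subset A ->
  (forall w, w \in A -> e v w = (w \in N)) ->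
  \sum_(w in A) adj v w * F w = \sum_(w in N) F w.
Proof.
move=> NA vN; rewrite (big_setID N) /= (setIidPr NA) [X in _ + X]big1 ?addr0 //.
  apply: eq_bigr => w wN; rewrite /adj vN ?wN ?mul1r //; exact: (subsetP NA).
by move=> w /setDP[wA wN]; rewrite /adj vN // (negPf wN) mul0r.
Qed.

Lemma deg_nbr (N : {set T}) v : N \subset A ->
  (forall w, w \in A -> e v w = (w \in N)) -> deg A v = #|N|%:R.
Proof.
move=> NA vN; rewrite /deg (eq_bigr (fun w => adj v w * 1)) => [|w _]; last by rewrite mulr1.
by rewrite (sum_nbr (fun=> 1) NA vN) sumr_const.
Qed.

Let nbA v := [set w in A | e v w].

Lemma nbA_sub v : nbA v \subset A.
Proof. by apply/subsetP => w; rewrite inE => /andP[]. Qed.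

Lemma nbAI v w : w \in A -> e v w -> w \in nbA v.
Proof. by move=> wA vw; rewrite in_set wA. Qed.

Lemma nbAE v w : w \in nbA v -> w \in A /\ e v w.
Proof. by rewrite in_set => /andP. Qed.

Lemma deg_nbA v : deg A v = #|nbA v|%:R.
Proof. by apply: deg_nbr (nbA_sub v) _ => w wA; rewrite in_set wA. Qed.

Lemma e_neq v w : e v w -> v != w.
Proof. by move=> vw; apply: contraTneq vw => ->; rewrite ei. Qed.

Lemma nbA_leaf v w : w \in A -> e v w -> (forall z, z \in A -> e v z -> z = w) -> nbA v = [set w].
Proof.
move=> wA vw h; apply/setP => z; apply/idP/set1P => [|->]; last by rewrite in_set wA.
by rewrite in_set => /andP[]; exact: h.
Qed.

(** Only the edges from [a] and [b] to [B] are counted. A vertex [w] of [B] cannot see all of [a],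
    [b], [c], because of the fan at [c] along [l0, u, a, w, b]. *)
Lemma strong_C3_pendant a b c l0 : a \in A -> b \in A -> c \in A -> l0 \in A ->
  e a b -> e b c -> e c a -> e c l0 -> l0 != a -> l0 != b ->
  (forall w, w \in A -> e a w -> w = b \/ w = c) ->
  (forall w, w \in A -> e b w -> w = a \/ w = c) ->
  (forall l w, l \in A -> e c l -> l != a -> l != b -> w \in A -> e l w -> w = c) ->
  closedA (c |: nbA c) /\ strong (c |: nbA c).
Proof.
move=> aA bA cA lA ab bc ca cl la lb Ha Hb Hl.
have [ba cb ac] := And3 (eC ab) (eC bc) (eC ca).
have [nab nbc nca] := And3 (e_neq ab) (e_neq bc) (e_neq ca).
have aN := nbAI aA ca; have bN := nbAI bA cb.
split.
  split; first by rewrite subUset sub1set cA nbA_sub.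
  move=> v w /setU1P[-> cw wA|/nbAE[vA cv] vw wA]; first by rewrite setU1r // nbAI.
  have [va|va] := eqVneq v a.
    by rewrite va in vw; case: (Ha w wA vw) => ->; rewrite ?setU11 ?setU1r.
  have [vb|vb] := eqVneq v b.
    by rewrite vb in vw; case: (Hb w wA vw) => ->; rewrite ?setU11 ?setU1r.
  by rewrite (Hl v w) // setU11.
set C := c |: nbA c.
pose L := nbA c :\ a :\ b.
have sumC (F : T -> R) : \sum_(w in C) F w = F c + (F a + (F b + \sum_(w in L) F w)).
  rewrite big_setU1 /= ?in_set ?ei ?andbF // (big_setD1 a) //= (big_setD1 b) //=.
  by rewrite in_setD1 bN andbT eq_sym.
have dc : deg A c = #|L|%:R + 2.
  rewrite deg_nbA (cardsD1 a) aN (cardsD1 b) in_setD1 bN eq_sym nab /= !natrD; ring.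
have da : deg A a = 2.
  rewrite (@deg_nbr [set b; c]) ?cards2 ?nbc //.
    by apply/subsetP => w /set2P[]->.
  by move=> w wA; apply/idP/set2P => [/(Ha w wA)|[]->].
have db : deg A b = 2.
  rewrite (@deg_nbr [set a; c]) ?cards2 1?eq_sym ?nca //.
    by apply/subsetP => w /set2P[]->.
  by move=> w wA; apply/idP/set2P => [/(Hb w wA)|[]->].
have dl l : l \in L -> deg A l = 1.
  move=> /setD1P[lb' /setD1P[la' /nbAE[lA' cl']]].
  by rewrite deg_nbA (nbA_leaf cA (eC cl')) ?cards1 // => z zA lz; apply: (Hl l).
have L1 : 1 <= #|L|%:R :> R.
  by rewrite ler1n card_gt0; apply/set0Pn; exists l0; rewrite !in_setD1 lb la nbAI.
pose k : R := #|L|%:R.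
have etaE : 1 + eta C = x a + x b + (k + 1) * x c - 2 - k.
  rewrite /eta sumC dc da db.
  rewrite (eq_bigr (fun=> - 2^-1)) => [|l lL]; last by rewrite (dl l lL); field.
  by rewrite sumr_const -mulr_natl -/k; field.
have [h|h] := ltrP (1 + eta C) 0; first exact: strong_of_eta.
have Ra : lam * x a - 1 - x b - x c <= cnt a.
  have := countB aA; rewrite (@sum_nbr [set b; c]) => [||w wA].
  - by rewrite big_setU1 ?inE //= big_set1 -/(cnt _); lra.
  - by apply/subsetP => w /set2P[]->.
  by apply/idP/set2P => [/(Ha w wA)|[]->].
have Rb : lam * x b - 1 - x a - x c <= cnt b.
  have := countB bA; rewrite (@sum_nbr [set a; c]) => [||w wA].
  - by rewrite big_setU1 ?inE 1?eq_sym //= big_set1 -/(cnt _); lra.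
  - by apply/subsetP => w /set2P[]->.
  by apply/idP/set2P => [/(Hb w wA)|[]->].
have xb01 v : 0 <= x v <= 1 by rewrite x_ge0 x_le1.
have xa := xb01 a; have xb := xb01 b; have xc := xb01 c.
pose s := x a + x b + (k + 1) * x c - 2 - k.
have s0 : 0 <= s by rewrite /s -etaE.
(* There is at least one pendant; with [x a + x b <= 2] this bounds [x c] below by [(1 + s) / 2]. *)
have kc : 2 * (1 - x c) <= (k + 1) * (1 - x c) by apply: ler_wpM2r; rewrite /k; lra.
have sx : x a + x b = 1 + s + (k + 1) * (1 - x c) by rewrite /s; ring.
have xc2 : (1 + s) / 2 <= x c by lra.
have l0p : 0 < lam by have := lam9; lra.
(* The neighbour [u] contributes 1 and the neighbour [c] at least 1/2, as [s >= 0]. *)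
have lx v : v \in A -> e v c -> 3 / 2 <= lam * x v.
  move=> vA vc; rewrite (eigA vA).
  have : x c <= \sum_(w in A) adj v w * x w.
    rewrite (bigD1 c) //= (adj1 vc) mul1r lerDl.
    by apply: sumr_ge0 => z _; rewrite mulr_ge0 ?adj_ge0.
  have : 0 <= \sum_(b in B) adj v b * x b.
    by apply: sumr_ge0 => z _; rewrite mulr_ge0 ?adj_ge0.
  lra.
have l3 v : v \in A -> e v c -> 3 / lam <= 2 * x v.
  by move=> vA vc; rewrite ler_pdivrMr //; have := lx v vA vc; lra.
(* The multiplier [kap] below is the smaller of [m] and [(1 + s) / 2]; the two outcomes are the
   alternatives of [C3p_final]. *)
pose m := Num.max (2 * s) (3 / lam).
have ma : m <= 2 * x a by rewrite ge_max (l3 a aA ac) andbT; lra.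
have mb : m <= 2 * x b by rewrite ge_max (l3 b bA bc) andbT; lra.
have [kap [kap_c kap_a kap_b kap_fin]] : exists kap : R,
    [/\ kap <= x c, kap <= 2 * x a, kap <= 2 * x b &
    2 * kap = 1 + s \/ 2 * s <= kap /\ 3 <= lam * kap].
  have [mk|mk] := lerP ((1 + s) / 2) m.
    by exists ((1 + s) / 2); split; try lra; left; field.
  exists m; split => //; first by lra.
  right; split; first by rewrite le_max lexx.
  by rewrite mulrC -ler_pdivrMr // le_max lexx orbT.
have key : \sum_(w in B) kap * (adj w a + adj w b) <= Phi C.
  apply: (@Phi_lower_fun [:: a; b; c]) => //.
  - by rewrite /= !inE !negb_or nab nbc [a == c]eq_sym nca.
  - by move=> v; rewrite in_cons mem_seq2 => /or3P[]/eqP->; rewrite ?setU11 ?setU1r.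
  move=> w wB; rewrite /beta !big_cons !big_nil.
  apply: C3p_pointwise => //.
  apply/negP => /and3P[wa wb wc].
  apply: (no_fan_lupbq cA lA aA bA wB) (eC wc) (eC wa) wb => //.
  by rewrite /= !inE !negb_or la lb nab.
apply: lt_le_trans key; rewrite -mulr_sumr big_split /= -!/(cnt _) etaE -/s.
apply: C3p_final => //; first by lra.
have p1 : (lam - 1) * (1 + s) <= (lam - 1) * (x a + x b).
  by apply: ler_wpM2l; [have := lam9; lra | rewrite sx lerDl mulr_ge0 //; lra].
move: Ra Rb; lra.
Qed.

(** All neighbours in [A] of either centre, apart from the other centre, are leaves of the link.
    Stars and single edges are included. *)
Definition double_star c1 c2 :=
  [/\ c1 \in A, c2 \in A, e c1 c2,
    forall v w, v \in A -> e c1 v -> v != c2 -> w \in A -> e v w -> w = c1 &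
    forall v w, v \in A -> e c2 v -> v != c1 -> w \in A -> e v w -> w = c2].

(** Each centre lies in the neighbourhood of the other, and a common neighbour would be a leaf with
    two neighbours; so the two neighbourhoods partition the component. *)
Lemma double_star_sum c1 c2 (F : T -> R) : double_star c1 c2 ->
  \sum_(w in nbA c1 :|: nbA c2) F w =
  F c2 + \sum_(w in nbA c1 :\ c2) F w + (F c1 + \sum_(w in nbA c2 :\ c1) F w).
Proof.
move=> [c1A c2A c12 H1 H2].
rewrite sum_setU; first by rewrite (big_setD1 _ (nbAI c2A c12)) (big_setD1 _ (nbAI c1A (eC c12))).
rewrite disjoint_subset; apply/subsetP => v /nbAE[vA c1v]; rewrite !inE.
apply/negP => /andP[_ c2v].
have vc2 : v != c2 by rewrite eq_sym e_neq.
by have /eqP := H1 v c2 vA c1v vc2 c2A (eC c2v); rewrite eq_sym (negPf (e_neq c12)).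
Qed.

Lemma double_star_closed c1 c2 : double_star c1 c2 -> closedA (nbA c1 :|: nbA c2).
Proof.
move=> [c1A c2A c12 H1 H2]; split; first by rewrite subUset !nbA_sub.
move=> v w /setUP[]/nbAE[vA cv] vw wA; apply/setUP.
- have [vc|vc] := eqVneq v c2; first by right; rewrite nbAI // -vc.
  by right; rewrite (H1 v w) // nbAI // es.
- have [vc|vc] := eqVneq v c1; first by left; rewrite nbAI // -vc.
  by left; rewrite (H2 v w) // nbAI.
Qed.

(** A leaf contributes [-1/2] whatever its weight, so only the centres' entries survive. *)
Lemma double_star_eta c1 c2 : double_star c1 c2 ->
  1 + eta (nbA c1 :|: nbA c2) =
  - ((deg A c1 - 1) * (1 - x c1) + (deg A c2 - 1) * (1 - x c2)).
Proof.
move=> ds; rewrite /eta (double_star_sum _ ds); case: ds => [c1A c2A c12 H1 H2].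
have leaf p q : p \in A -> (forall v w, v \in A -> e p v -> v != q -> w \in A -> e v w -> w = p) ->
    q \in A -> e p q ->
    \sum_(w in nbA p :\ q) ((deg A w - 1) * x w - deg A w / 2) = - (deg A p - 1) / 2.
  move=> pA H qA pq.
  rewrite (eq_bigr (fun=> - 2^-1)) => [|l /setD1P[lq /nbAE[lA pl]]].
    rewrite sumr_const [in RHS]deg_nbA (cardsD1 q (nbA p)) (nbAI qA pq) natrD /=.
    by rewrite -[- 2^-1 *+ _]mulr_natl; field.
  rewrite [deg A l]deg_nbA (nbA_leaf pA (eC pl)) ?cards1; first by field.
  by move=> z zA lz; apply: (H l).
rewrite (leaf c1 c2) // (leaf c2 c1) //; last exact: eC.
by field.
Qed.

Lemma deg_nbA_ge1 c1 c2 : c2 \in A -> e c1 c2 -> 1 <= deg A c1.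
Proof. by move=> c2A c12; rewrite deg_nbA ler1n card_gt0; apply/set0Pn; exists c2; exact: nbAI. Qed.

Lemma double_star_eta_le c1 c2 : double_star c1 c2 -> 1 + eta (nbA c1 :|: nbA c2) <= 0.
Proof.
move=> ds; rewrite (double_star_eta ds); case: ds => [c1A c2A c12 _ _].
rewrite oppr_le0; have d1 := deg_nbA_ge1 c2A c12; have d2 := deg_nbA_ge1 c1A (eC c12).
by apply: addr_ge0; apply: mulr_ge0; rewrite subr_ge0 ?x_le1.
Qed.

(** A neighbour in [A] off the cycle, followed by the cycle, would be a path on five vertices in the
    link. *)
Lemma four_cycle_closed a b c d : {subset [:: a; b; c; d] <= A} -> uniq [:: a; b; c; d] ->
  e a b -> e b c -> e c d -> e d a -> closedA [set w in [:: a; b; c; d]].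
Proof.
set s := [:: a; b; c; d] => sA us ab bc cd da.
split; first by apply/subsetP => w; rewrite in_set; exact: sA.
move=> v w vs vw wA; rewrite in_set in vs; rewrite in_set; apply: contraT => ws.
have P5 p q r t : perm_eq [:: p; q; r; t] s -> v = p -> e p q -> e q r -> e r t -> False.
  move=> ps vp pq qr rt; apply: (@no_P5 w p q r t).
  - by move=> z; rewrite in_cons (perm_mem ps) => /orP[/eqP->//|]; exact: sA.
  - by rewrite cons_uniq (perm_mem ps) ws (perm_uniq ps).
  by rewrite /= pq qr rt -vp (eC vw).
move: vs; rewrite !inE => /or4P[]/eqP vE; exfalso.
- exact: (P5 a b c d).
- by apply: (P5 b c d a) => //; rewrite -[[:: b; c; d; a]]/(rot 1 s) perm_rot.
- by apply: (P5 c d a b) => //; rewrite -[[:: c; d; a; b]]/(rot 2 s) perm_rot.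
- by apply: (P5 d a b c) => //; rewrite -[[:: d; a; b; c]]/(rot 3 s) perm_rot.
Qed.

(** * Splitting a component off the link *)

Section Piece.
Variable S : {set T}.
Hypothesis clS : closedA S.

Let SA v : v \in S -> v \in A. Proof. exact: (subsetP clS.1). Qed.
Let Sn v w : v \in S -> e v w -> w \in A -> w \in S. Proof. exact: clS.2. Qed.

Lemma piece_4cycle a b c d : {subset [:: a; b; c; d] <= S} -> uniq [:: a; b; c; d] ->
  e a b -> e b c -> e c d -> e d a ->
  exists C, [/\ C \subset S, closedA C, C != set0 & strong C].
Proof.
move=> sS us ab bc cd da.
have cl : closedA [set w in [:: a; b; c; d]].
  by apply: four_cycle_closed => // w /sS /SA.
exists [set w in [:: a; b; c; d]]; split => //.
- by apply/subsetP => w; rewrite in_set; exact: sS.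
- by apply/set0Pn; exists a; rewrite in_set mem_head.
- exact: strong_4cycle.
Qed.

Hypothesis no4 : forall a b c d, {subset [:: a; b; c; d] <= A} -> a \in S ->
  uniq [:: a; b; c; d] -> e a b -> e b c -> e c d -> e d a -> False.

(** A further neighbour [w] of [a] or [b] closes a 4-cycle if [w = l0] and otherwise starts a
    five-vertex path ending in [c, l0]. A pendant with a second neighbour similarly gives a 4-cycle
    through [a] and [b] or a path ending in [c, a, b]. *)
Lemma piece_triangle_pendant a b c l0 : a \in S -> b \in S -> c \in S -> l0 \in A ->
  e a b -> e b c -> e c a -> e c l0 -> l0 != a -> l0 != b ->
  exists C, [/\ C \subset S, closedA C, C != set0 & strong C].
Proof.
move=> aS bS cS lA ab bc ca cl la lb.
have [aA bA cA] := And3 (SA aS) (SA bS) (SA cS).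
have [ba cb ac] := And3 (eC ab) (eC bc) (eC ca).
have [nab nbc nca] := And3 (e_neq ab) (e_neq bc) (e_neq ca).
have lc : l0 != c by rewrite eq_sym e_neq.
have sub4 p q r t : p \in A -> q \in A -> r \in A -> t \in A -> {subset [:: p; q; r; t] <= A}.
  by move=> pA qA rA tA z; rewrite in_cons in_cons mem_seq2 => /or4P[]/eqP->.
have Hgen p q : p \in S -> q \in S -> e p q -> e q c -> e p c -> l0 != p -> l0 != q ->
    forall w, w \in A -> e p w -> w = q \/ w = c.
  move=> pS qS pq qc pc lp lq w wA pw.
  have [pA qA] := conj (SA pS) (SA qS).
  have [->|wq] := eqVneq w q; first by left.
  have [->|wc] := eqVneq w c; first by right.
  have [npq nqc npc npw] := And4 (e_neq pq) (e_neq qc) (e_neq pc) (e_neq pw).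
  exfalso; have [wl|wl] := eqVneq w l0.
    apply: (@no4 c l0 p q) => //; [exact: sub4| | by rewrite -wl; exact: eC].
    by rewrite /= !inE !negb_or [c == _]eq_sym lc lp lq npq [c == _]eq_sym npc [c == _]eq_sym nqc.
  apply: (@no_P5 w p q c l0).
  - by move=> z; rewrite in_cons => /orP[/eqP->//|]; exact: sub4.
  - rewrite /= !inE !negb_or wq wc wl npq npc nqc [w == p]eq_sym npw.
    by rewrite [p == l0]eq_sym lp [q == l0]eq_sym lq [c == l0]eq_sym lc.
  by rewrite /= pq qc cl (eC pw).
exists (c |: nbA c).
have := @strong_C3_pendant a b c l0 aA bA cA lA ab bc ca cl la lb.
case=> [|||clC st].
- exact: (Hgen a b).
- exact: (Hgen b a).
- move=> l w lA' cl' la' lb' wA lw; apply/eqP; apply: contraT => wc; exfalso.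
  have nlw := e_neq lw; have nlc := e_neq (eC cl').
  have [wa|wa] := eqVneq w a.
    rewrite wa in lw; apply: (@no4 c l a b) => //; first exact: sub4.
    by rewrite /= !inE !negb_or la' lb' nab [c == l]eq_sym nlc nca [c == b]eq_sym nbc.
  have [wb|wb] := eqVneq w b.
    rewrite wb in lw; apply: (@no4 c l b a) => //; first exact: sub4.
    by rewrite /= !inE !negb_or la' lb' [b == a]eq_sym nab [c == l]eq_sym nlc nca [c == b]eq_sym nbc.
  apply: (@no_P5 w l c a b).
  - by move=> z; rewrite in_cons => /orP[/eqP->//|]; exact: sub4.
  - rewrite /= !inE !negb_or wc wa wb [w == l]eq_sym nlw nlc la' lb' nca nab.
    by rewrite [c == b]eq_sym nbc.
  by rewrite /= ca ab (eC lw) (eC cl').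
split => //; last by apply/set0Pn; exists c; rewrite setU11.
rewrite subUset sub1set cS; apply/subsetP => z /nbAE[zA cz]; exact: Sn cz zA.
Qed.

Lemma piece_triangle a b c : a \in S -> e a b -> e b c -> e c a -> b \in A -> c \in A ->
  exists C, [/\ C \subset S, closedA C, C != set0 & strong C].
Proof.
move=> aS ab bc ca bA cA; have bS := Sn aS ab bA; have cS := Sn bS bc cA.
have [nab nbc nca] := And3 (e_neq ab) (e_neq bc) (e_neq ca).
have us : uniq [:: a; b; c] by rewrite /= !inE !negb_or nab nbc [a == c]eq_sym nca.
have [h|] := boolP [forall v, (v \in [:: a; b; c]) ==>
    [forall w, (w \in A) && e v w ==> (w \in [:: a; b; c])]].
  have cl : closedA [set w in [:: a; b; c]].
    split; first by apply/subsetP => w; rewrite in_set in_cons mem_seq2 => /or3P[]/eqP->; exact: SA.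
    move=> v w vs vw wA; rewrite in_set in vs; rewrite in_set.
    by move/forallP/(_ v): h; rewrite vs => /forallP/(_ w); rewrite wA vw.
  exists [set w in [:: a; b; c]]; split => //; last exact: strong_C3.
    by apply/subsetP => w; rewrite in_set in_cons mem_seq2 => /or3P[]/eqP->.
  by apply/set0Pn; exists a; rewrite in_set mem_head.
rewrite negb_forall => /existsP[v]; rewrite negb_imply => /andP[vs].
rewrite negb_forall => /existsP[w]; rewrite negb_imply => /andP[/andP[wA vw]].
rewrite in_cons mem_seq2 !negb_or => /and3P[wa wb wc].
move: vs; rewrite in_cons mem_seq2 => /or3P[]/eqP vE; rewrite vE in vw.
- exact: (@piece_triangle_pendant b c a w).
- exact: (@piece_triangle_pendant c a b w).
- exact: (@piece_triangle_pendant a b c w).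
Qed.

Hypothesis no3 : forall a b c, a \in S -> b \in A -> c \in A -> e a b -> e b c -> e c a -> False.

Lemma piece_double_star v0 w0 : v0 \in S -> w0 \in A -> e v0 w0 ->
  exists c1 c2, [/\ c1 \in S, c2 \in S & double_star c1 c2].
Proof.
move=> v0S w0A vw0.
pose P (p : T * T) := [&& p.1 \in S, p.2 \in S & e p.1 p.2].
pose f (p : T * T) := (#|nbA p.1| + #|nbA p.2|)%N.
have P0 : P (v0, w0) by rewrite /P /= v0S vw0 (Sn v0S vw0).
(* Maximality of the degree sum makes all further neighbours leaves. *)
have [[c1 c2] /= /and3P[/= c1S c2S c12] fmax] := arg_maxnP f P0.
have leaf p q : p \in S -> q \in S -> e p q -> (forall r t, P (r, t) -> (f (r, t) <= f (p, q))%N) ->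
    forall v w, v \in A -> e p v -> v != q -> w \in A -> e v w -> w = p.
  move=> pS qS pq mx v w vA pv vq wA vw; apply/eqP; apply: contraT => wp; exfalso.
  have [pA qA] := conj (SA pS) (SA qS).
  have vS := Sn pS pv vA.
  have wq : w != q by apply/eqP => wE; rewrite wE in vw; exact: (@no3 p v q) (eC pq).
  (* Another neighbour [z] of [q] closes a triangle if [z = v], a 4-cycle if [z = w], and otherwise
     gives the path [w, v, p, q, z]. *)
  have nq : nbA q = [set p].
    apply: nbA_leaf (eC pq) _ => // z zA qz; apply/eqP; apply: contraT => zp; exfalso.
    have zv : z != v by apply/eqP => zE; rewrite zE in qz; exact: (@no3 p q v) (eC pv).
    have [zw|zw] := eqVneq z w.
      apply: (@no4 p q z v) => //; last exact: eC.
      - by move=> y; rewrite in_cons in_cons mem_seq2 => /or4P[]/eqP->.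
      - rewrite /= !inE !negb_or zv (e_neq pq) (e_neq pv) (e_neq qz) [p == z]eq_sym zp.
        by rewrite [q == v]eq_sym vq.
      - by rewrite zw; exact: eC.
    apply: (@no_P5 w v p q z).
    - by move=> y; rewrite in_cons in_cons in_cons mem_seq2 => /orP[/eqP->//|/or4P[]/eqP->].
    - rewrite /= !inE !negb_or wp wq vq (e_neq pq) (e_neq qz).
      rewrite [w == v]eq_sym (e_neq vw) [w == z]eq_sym zw [v == p]eq_sym (e_neq pv).
      by rewrite [v == z]eq_sym zv [p == z]eq_sym zp.
    by rewrite /= pq qz (eC vw) (eC pv).
  (* Now [q] has degree 1 and [v] degree at least 2 in the link, so the edge [v p] beats the maximal
     edge [p q]. *)
  have := mx v p; rewrite /P /f /= vS pS (eC pv) nq cards1 => /(_ isT).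
  rewrite addnC leq_add2l leqNgt (cardsD1 p) (nbAI pA (eC pv)) /= (cardsD1 w).
  by rewrite in_setD1 wp nbAI.
exists c1, c2; split => //; split; rewrite ?SA //.
- by apply: (leaf c1 c2) => // r t /fmax.
- by apply: (leaf c2 c1) (eC c12) _ => // r t /fmax; rewrite /f /= [(#|nbA c2| + _)%N]addnC.
Qed.
End Piece.

Lemma piece S v0 w0 : closedA S -> v0 \in S -> w0 \in A -> e v0 w0 ->
  exists C, [/\ C \subset S, closedA C, C != set0 &
    strong C \/ exists c1 c2, double_star c1 c2 /\ C = nbA c1 :|: nbA c2].
Proof.
move=> clS v0S w0A vw0.
have weaken : (exists C, [/\ C \subset S, closedA C, C != set0 & strong C]) ->
  exists C, [/\ C \subset S, closedA C, C != set0 &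
    strong C \/ exists c1 c2, double_star c1 c2 /\ C = nbA c1 :|: nbA c2].
  by case=> C [? ? ? ?]; exists C; split => //; left.
have [|no4b] := boolP [exists a, exists b, exists c, exists d,
    [&& all (mem S) [:: a; b; c; d], uniq [:: a; b; c; d], e a b, e b c, e c d & e d a]].
  move=> /existsP[a /existsP[b /existsP[c /existsP[d /and5P[/allP sS us ab bc /andP[cd da]]]]]].
  by apply: weaken; apply: (piece_4cycle clS) us ab bc cd da.
have no4 a b c d : {subset [:: a; b; c; d] <= A} -> a \in S ->
    uniq [:: a; b; c; d] -> e a b -> e b c -> e c d -> e d a -> False.
  move=> sA aS us ab bc cd da.
  have bS : b \in S by apply: (clS.2 a) => //; apply: sA; rewrite !in_cons eqxx orbT.
  have cS : c \in S by apply: (clS.2 b) => //; apply: sA; rewrite !in_cons eqxx !orbT.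
  have dS : d \in S by apply: (clS.2 c) => //; apply: sA; rewrite !in_cons eqxx !orbT.
  move/negP: no4b; apply; apply/existsP; exists a; apply/existsP; exists b.
  by apply/existsP; exists c; apply/existsP; exists d; rewrite us ab bc cd da /= aS bS cS dS.
have [|no3b] := boolP [exists a, exists b, exists c,
    [&& a \in S, b \in A, c \in A, e a b, e b c & e c a]].
  move=> /existsP[a /existsP[b /existsP[c /and5P[aS bA cA ab /andP[bc ca]]]]].
  by apply: weaken; apply: (piece_triangle clS no4 aS ab bc ca).
have no3 a b c : a \in S -> b \in A -> c \in A -> e a b -> e b c -> e c a -> False.
  move=> aS bA cA ab bc ca; move/negP: no3b; apply.
  apply/existsP; exists a; apply/existsP; exists b; apply/existsP; exists c.
  by apply/and5P; split; rewrite ?ca ?bc.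
have [c1 [c2 [c1S c2S ds]]] := piece_double_star clS no4 no3 v0S w0A vw0.
exists (nbA c1 :|: nbA c2); split.
- by apply/subsetP => w /setUP[]/nbAE[wA cw]; apply: clS.2 cw wA.
- exact: double_star_closed.
- by apply/set0Pn; exists c2; apply/setUP; left; case: ds => *; exact: nbAI.
- by right; exists c1, c2.
Qed.

(** * The spectral bound and the structure at equality *)

Lemma lam_gt0 : 0 < lam. Proof. by have := lam9; lra. Qed.

(** Induction on the size of [S], splitting off one component. A strong one gains [lam], a double
    star has [eta <= -1], and an isolated vertex has [eta = - x v < 0]; superadditivity adds the
    pieces. *)
Lemma Phi_gt_eta S : closedA S -> S != set0 -> lam * eta S < Phi S.
Proof.
have l0 := lam_gt0.
have [n] := ubnP #|S|; elim: n S => // n IH S ltS clS S0.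
have [C [CS clC C0 hC]] : exists C, [/\ C \subset S, closedA C, C != set0 & lam * eta C < Phi C].
  have [/existsP[v /existsP[w /and3P[vS wA vw]]]|none] :=
      boolP [exists v, exists w, [&& v \in S, w \in A & e v w]].
    have [C [CS clC C0 H]] := piece clS vS wA vw; exists C; split => //.
    case: H => [|[c1 [c2 [ds CE]]]]; first by rewrite /strong mulrDr; lra.
    have := double_star_eta_le ds; rewrite -CE => h.
    have h1 : lam * (1 + eta C) <= 0 by rewrite mulr_ge0_le0 // ltW.
    by move: h1; rewrite mulrDr; have := Phi_ge0 C; lra.
  have /set0Pn[v vS] := S0; have vA := subsetP clS.1 v vS.
  have iso w : w \in A -> e v w = false.
    move=> wA; apply: contraNF none => vw; apply/existsP; exists v; apply/existsP; exists w.
    by rewrite vS wA.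
  exists [set v]; split; rewrite ?sub1set //.
  - split; first by rewrite sub1set.
    by move=> z w /set1P-> vw wA; rewrite iso in vw.
  - by apply/set0Pn; exists v; rewrite set11.
  apply: lt_le_trans (Phi_ge0 _); rewrite pmulr_rlt0 // /eta big_set1.
  have -> : deg A v = 0 by rewrite /deg big1 // => w wA; rewrite /adj iso.
  have : 0 < x v by rewrite -(pmulr_rgt0 _ l0); have := lam_x_ge1 vA; lra.
  lra.
have dis : [disjoint C & S :\: C] by rewrite disjoints_subset setCD subsetUr.
have SE : S = C :|: S :\: C by rewrite -{1}(setID S C) (setIidPr CS).
have hD : lam * eta (S :\: C) <= Phi (S :\: C).
  have [->|D0] := eqVneq (S :\: C) set0; first by rewrite /eta big_set0 mulr0 Phi_ge0.
  apply/ltW/IH => //; last exact: closedAD.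
  rewrite -ltnS; apply: leq_trans ltS; rewrite ltnS.
  apply: proper_card; rewrite properEneq subsetDl andbT.
  have /set0Pn[v vC] := C0; apply/eqP => /setP/(_ v); rewrite in_setD vC /=.
  by rewrite (subsetP CS).
rewrite SE eta_add //; apply: lt_le_trans (Phi_superadd dis); rewrite mulrDr; lra.
Qed.

Lemma closedA_A : closedA A. Proof. by split. Qed.

Let M : R := (\sum_v \sum_w adj v w) / 2.

Lemma loss_ge0 : 0 <= loss.
Proof. by rewrite -(pmulr_rge0 _ lam_gt0); apply: le_trans Phi_le_loss; exact: Phi_ge0. Qed.

(** The assumption gives [loss <= 1 + eta A], hence [Phi A <= lam * (1 + eta A)]. An edgeless link
    has [eta A = - lam], and a strong component or a double star with a nonempty remainder violates
    this inequality. For a lone double star, [0 <= loss <= 1 + eta A <= 0]. *)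
Lemma extremal_link : M - 1 <= lam ^+ 2 - lam ->
  exists c1 c2, [/\ double_star c1 c2, A = nbA c1 :|: nbA c2, 1 + eta A = 0 & loss = 0].
Proof.
move=> hM; have := spectral_identity; rewrite -/M => idE.
have loss0 := loss_ge0; have l0 := lam_gt0.
have le1 : Phi A <= lam * (1 + eta A).
  by apply: le_trans Phi_le_loss _; rewrite ler_pM2l //; lra.
have [/existsP[v /existsP[w /and3P[vA wA vw]]]|none] :=
    boolP [exists v, exists w, [&& v \in A, w \in A & e v w]]; last first.
  have etaE : eta A = - lam.
    rewrite -sumA_x -sumrN; apply: eq_bigr => v vA.
    have -> : deg A v = 0; last by field.
    rewrite /deg big1 // => w wA; rewrite /adj.
    case vw: (e v w) => //; case/negP: none.
    by apply/existsP; exists v; apply/existsP; exists w; rewrite vA wA.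
  by exfalso; move: idE etaE loss0 lam9 hM; lra.
have [C [CA clC C0 H]] := piece closedA_A vA wA vw.
have dis : [disjoint C & A :\: C] by rewrite disjoints_subset setCD subsetUr.
have AE : A = C :|: A :\: C by rewrite -{1}(setID A C) (setIidPr CA).
have sup := Phi_superadd dis; rewrite -AE in sup.
have etaD := eta_add dis; rewrite -AE in etaD.
case: H => [st|[c1 [c2 [ds CE]]]].
  have hD : lam * eta (A :\: C) <= Phi (A :\: C).
    have [->|D0] := eqVneq (A :\: C) set0; first by rewrite /eta big_set0 mulr0 Phi_ge0.
    by apply/ltW/Phi_gt_eta => //; exact: closedAD closedA_A clC.
  exfalso; move: st; rewrite /strong; move: le1; rewrite etaD !mulrDr; lra.
have etaC := double_star_eta_le ds; rewrite -CE in etaC.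
have lC : lam * (1 + eta C) <= 0 by rewrite mulr_ge0_le0 // ltW.
have AC : A = C.
  have [D0|D0] := eqVneq (A :\: C) set0; first by rewrite AE D0 setU0.
  have hD := Phi_gt_eta (closedAD closedA_A clC) D0.
  exfalso; move: le1 lC (Phi_ge0 C); rewrite etaD !mulrDr; lra.
exists c1, c2; rewrite -CE -AC; split => //; rewrite -AC in etaC; lra.
Qed.

Lemma spectral_bound : lam ^+ 2 - lam <= M - 1.
Proof.
have [h|/ltW//] := lerP (M - 1) (lam ^+ 2 - lam).
have [c1 [c2 [_ _ eta0 loss0]]] := extremal_link h.
by have := spectral_identity; rewrite -/M eta0 loss0; lra.
Qed.

(** Zero loss leaves no edge inside [B], and a vertex [b] with a neighbour in [A] has entry 1. Its
    neighbours then carry the whole weight [lam] of [A]; as entries on [A] are positive, [b] sees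
    all of [A], which gives a fan at [c1] along [l, u, p, b, q]. *)
Lemma loss0_isolated c1 : loss = 0 -> (2 < #|nbA c1|)%N -> c1 \in A ->
  forall b w, b \in B -> e b w = false.
Proof.
move=> loss0 n1 c1A b w bB; have l0 := lam_gt0.
have terms b' : b' \in B -> 0 <= deg A b' * (1 - x b') + deg B b' / 2.
  by move=> _; rewrite addr_ge0 ?mulr_ge0 ?deg_ge0 ?subr_ge0 ?invr_ge0 ?ler0n.
have := psumr_eq0P terms loss0 bB => t0.
have dAx : 0 <= deg A b * (1 - x b) by rewrite mulr_ge0 ?deg_ge0 ?subr_ge0.
have dB0 : deg B b = 0 by have := deg_ge0 B b; lra.
have dA0 : deg A b * (1 - x b) = 0 by move: t0; rewrite dB0; lra.
have degz S z : deg S b = 0 -> z \in S -> e b z = false.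
  move=> d0 zS; have := psumr_eq0P (fun z _ => adj_ge0 b z) d0 zS.
  by rewrite /adj; case: (e b z) => // /eqP; rewrite oner_eq0.
have degA0 : deg A b = 0.
  apply/eqP; apply: contraT => dN; exfalso.
  have x1 : x b = 1 by apply/eqP; move/eqP: dA0; rewrite mulf_eq0 (negPf dN) subr_eq0 eq_sym.
  have := eigB bB; rewrite x1 mulr1 [X in _ + X]big1 ?addr0; last first.
    by move=> z zB; rewrite /adj (degz _ z dB0 zB) mul0r.
  rewrite -{1}sumA_x => /eqP; rewrite -subr_eq0 -sumrB => /eqP sum0.
  have all z : z \in A -> e b z.
    move=> zA; have pos y : y \in A -> 0 <= x y - adj b y * x y.
      by move=> _; have := missF_ge0 b y; lra.
    have := psumr_eq0P pos sum0 zA; rewrite /adj; case: (e b z) => //=; rewrite mul0r subr0 => xz.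
    by have := lam_x_ge1 zA; rewrite xz mulr0 ler10.
  have /card_gt2P[l [p [q [[lN pN qN] [lp pq ql]]]]] := n1.
  have [[lA cl] [pA cp] [qA cq]] := And3 (nbAE lN) (nbAE pN) (nbAE qN).
  apply: (no_fan_lupbq c1A lA pA qA bB) (eC (all _ c1A)) (eC (all _ pA)) (all _ qA) => //.
  by rewrite /= !inE !negb_or lp pq [l == q]eq_sym ql.
have [->|wu] := eqVneq w u; first by move: bB; rewrite es inE => /andP[_ /negPf].
have [wA|wA] := boolP (w \in A); first exact: degz degA0 wA.
by apply: degz dB0 _; rewrite !inE wu in wA *.
Qed.

Lemma extremal_star : M - 1 <= lam ^+ 2 - lam ->
  exists c, [/\ c \in A, forall v w, v \in B -> e v w = false &
    forall v w, v \in A -> w \in A -> e v w = (v != w) && ((v == c) || (w == c))].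
Proof.
move=> hM; have [c1 [c2 [ds AE eta0 loss0]]] := extremal_link hM.
have l0 := lam_gt0.
have ds' : double_star c2 c1 by case: ds => ? ? ? ? ?; split => //; exact: eC.
wlog n12 : c1 c2 ds ds' AE / (#|nbA c2| <= #|nbA c1|)%N.
  move=> H; have [h|h] := leqP #|nbA c2| #|nbA c1|; first exact: (H c1 c2).
  by apply: (H c2 c1) => //; rewrite 1?setUC // ltnW.
have [c1A c2A c12 H1 H2] := ds.
(* Entries at most 1 sum to [lam >= 9] on [A], so the larger neighbourhood has more than two
   vertices. *)
have nA : (9 <= #|A|)%N.
  rewrite -(ler_nat R); apply: le_trans lam9 _; rewrite -sumA_x -sumr_const.
  by apply: ler_sum => w _; exact: x_le1.
have n1 : (2 < #|nbA c1|)%N by move: nA (cardsU (nbA c1) (nbA c2)); rewrite -AE; lia.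
have isoB := loss0_isolated loss0 n1 c1A.
have x1 : x c1 = 1.
  have d1 := deg_nbA_ge1 c2A c12; have d2 := deg_nbA_ge1 c1A (eC c12).
  have t1 : 0 <= (deg A c1 - 1) * (1 - x c1) by rewrite mulr_ge0 ?subr_ge0.
  have t2 : 0 <= (deg A c2 - 1) * (1 - x c2) by rewrite mulr_ge0 ?subr_ge0.
  have := double_star_eta ds; rewrite -AE eta0 => h.
  have /eqP : (deg A c1 - 1) * (1 - x c1) = 0 by lra.
  rewrite mulf_eq0 => /orP[|]; last by rewrite subr_eq0 eq_sym => /eqP.
  rewrite deg_nbA subr_eq0 pnatr_eq1 => /eqP h1; by rewrite h1 in n1.
(* As [x c1 = 1] and [c1] has no neighbour in [B], its eigenvalue equation reads
   [lam = 1 + sum over nbA c1]. The total weight [lam] of [A] exceeds this by the weight of the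
   leaves at [c2], which are positive. *)
have nb2 : nbA c2 :\ c1 = set0.
  apply/eqP; apply: contraT => /set0Pn[z zN]; exfalso.
  have zA : z \in A by case/setD1P: zN => _ /nbAE[].
  have := eigA c1A; rewrite x1 mulr1 (@sum_nbr (nbA c1)) ?nbA_sub //; last first.
    by move=> w wA; rewrite in_set wA.
  rewrite [X in _ + _ + X]big1 ?addr0; last first.
    by move=> b bB; rewrite adjC /adj isoB // mul0r.
  rewrite -{1}sumA_x AE (double_star_sum _ ds) x1 (big_setD1 _ (nbAI c2A c12)) /=.
  rewrite (big_setD1 _ zN) /=.
  have xz : 0 < x z by rewrite -(pmulr_rgt0 _ l0); have := lam_x_ge1 zA; lra.
  have : 0 <= \sum_(i in (nbA c2 :\ c1) :\ z) x i by apply: sumr_ge0.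
  lra.
have star v w : v \in A -> w \in A -> v != c1 -> e v w -> w = c1.
  move=> vA wA vc vw; have [vc2|vc2] := eqVneq v c2.
    apply/eqP; apply: contraT => wc; have : w \in nbA c2 :\ c1 by rewrite in_setD1 wc nbAI // -vc2.
    by rewrite nb2 in_set0.
  have : v \in nbA c1 :|: nbA c2 by rewrite -AE.
  move=> /setUP[/nbAE[_ c1v]|vn]; first exact: H1 vw.
  by have : v \in nbA c2 :\ c1; [rewrite in_setD1 vc | rewrite nb2 in_set0].
have hub w : w \in A -> w != c1 -> e c1 w.
  move=> wA wc; have : w \in nbA c1 :|: nbA c2 by rewrite -AE.
  move=> /setUP[/nbAE[]//|wn].
  by have : w \in nbA c2 :\ c1; [rewrite in_setD1 wc | rewrite nb2 in_set0].
exists c1; split => // v w vA wA; apply/idP/andP => [vw|[vw /orP[]/eqP E]].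
- split; first exact: e_neq.
  by have [//|vc] := eqVneq v c1; rewrite (star v w) ?eqxx.
- by rewrite E; apply: hub => //; rewrite -E eq_sym.
- by rewrite E; apply: eC; apply: hub => //; rewrite -E.
Qed.
End Link.

(** * Joins of an edge with an independent set *)

Section Book.
Variables (T : finType) (e : rel T).
Hypotheses (es : symmetric e) (ei : irreflexive e).

(** Vertices outside [u] and its neighbourhood are isolated, so [g] lists [u], [c] and the remaining
    neighbours of [u], and reaches every non-isolated vertex. *)
Lemma book_isomorphic u c : e u c ->
  (forall v w, v != u -> ~~ e u v -> e v w = false) ->
  (forall v w, e u v -> e u w -> e v w = (v != w) && ((v == c) || (w == c))) ->
  isomorphic (nonisol_rel e)
    (join_rel (complete_rel 2) (empty_rel #|[set w | e u w] :\ c|)).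
Proof.
move=> uc out star; set L := [set w | e u w] :\ c.
pose g (z : 'I_2 + 'I_#|L|) : T :=
  match z with inl i => if i == 0 :> nat then u else c | inr j => enum_val j end.
have LP (j : 'I_#|L|) : enum_val j != c /\ e u (enum_val j).
  by have := enum_valP j; rewrite !inE => /andP[].
have cu : c != u by apply: contraTneq uc => ->; rewrite ei.
have Lu (j : 'I_#|L|) : enum_val j != u.
  by have [_] := LP j; apply: contraTneq => ->; rewrite ei.
have gE a b : e (g a) (g b) = join_rel (complete_rel 2) (empty_rel #|L|) a b.
  case: a b => [i|i] [j|j] //=; rewrite /complete_rel /empty_rel.
  - by case: i j => [[|[|//]]] ? [[|[|//]]] ? //=; rewrite ?ei // es.
  - have [jc uj] := LP j; case: ifP => _ //.
    by rewrite star // eqxx andbT eq_sym jc.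
  - have [ic ui] := LP i; case: ifP => _; first by rewrite es.
    by rewrite star // eqxx orbT andbT ic.
  - have [jc uj] := LP j; have [ic ui] := LP i.
    by rewrite star // (negPf jc) (negPf ic) andbF.
have g_nonisol z : [exists y, e (g z) y].
  apply/existsP; case: z => [i|j] /=; last by exists u; rewrite es; case: (LP j).
  by case: ifP => _; [exists c | exists u; rewrite es].
pose G z : nonisol e := exist _ (g z) (g_nonisol z).
have g_inj : injective g.
  move=> [i|i] [j|j] //=.
  - by case: i j => [[|[|//]]] p [[|[|//]]] q //= E;
      rewrite ?E ?eqxx // in cu *; congr inl; apply: val_inj.
  - by case: ifP => _ E; [have := Lu j | have [] := LP j]; rewrite -E eqxx.
  - by case: ifP => _ E; [have := Lu i | have [] := LP i]; rewrite E eqxx.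
  - by move/enum_val_inj ->.
have G_inj : injective G by move=> a b /(congr1 val) /g_inj.
have g_surj v : [exists y, e v y] -> exists z, g z = v.
  move=> /existsP[y vy]; have [->|vu] := eqVneq v u; first by exists (inl ord0).
  have [uv|uv] := boolP (e u v); last by rewrite out in vy.
  have [->|vc] := eqVneq v c; first by exists (inl (lift ord0 ord0)).
  have vL : v \in L by rewrite !inE vc.
  by exists (inr (enum_rank_in vL v)); rewrite /= enum_rankK_in.
have G_bij : bijective G.
  apply: inj_card_bij => //; rewrite -(card_codom G_inj); apply: subset_leq_card.
  apply/subsetP => -[v pv] _; have [z zv] := g_surj v pv.
  by apply/codomP; exists z; apply: val_inj.
have [F GK FK] := G_bij; exists F; split; first by exists G.
by move=> a b; rewrite -{2}[a]FK -{2}[b]FK /nonisol_rel /= gE.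
Qed.
End Book.

Section JoinSums.
Variables (R : realFieldType) (T : finType) (e : rel T) (t : nat).
Hypotheses (eg : simple_graph e).
Hypothesis iso : isomorphic (nonisol_rel e) (join_rel (complete_rel 2) (empty_rel t)).
Local Notation J := (join_rel (complete_rel 2) (empty_rel t)).

Lemma join_sum (al be : R) (z : 'I_2 + 'I_t) :
  \sum_(s | J z s) (match s with inl _ => al | inr _ => be end) =
  match z with inl _ => al + t%:R * be | inr _ => 2 * al end.
Proof.
rewrite big_sumType /=; case: z => [i|j] /=; rewrite /complete_rel /empty_rel.
  rewrite !sumr_const (eq_card (_ : _ =i [set~ i])) => [|j]; last by rewrite !inE eq_sym.
  by rewrite cardsC1 card_ord -[_ *+ #|_|]mulr_natl card_ord.
by rewrite sumr_const card_ord big_pred0_eq addr0 mulr_natl.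
Qed.

(** Transfers sums to the join; [P] must avoid isolated vertices, which have no counterpart
    there. *)
Lemma nonisol_sum : exists g : 'I_2 + 'I_t -> T, [/\ injective g,
  forall a b, e (g a) (g b) = J a b &
  forall (P : pred T) (F : T -> R), (forall w, P w -> [exists y, e w y]) ->
    \sum_(w | P w) F w = \sum_(s | P (g s)) F (g s)].
Proof.
have [f [[h fK hK] fE]] := iso.
have g_inj : injective (fun s => val (h s)) by move=> a b /val_inj; exact: (can_inj hK).
exists (fun s => val (h s)); split => //.
  by move=> a b; rewrite -[in RHS](hK a) -[in RHS](hK b) fE.
move=> P F nonP.
rewrite (reindex_omap (fun s => val (h s)) (fun w => omap f (insub w : option (nonisol e)))) /=.
  apply: eq_bigl => s; have -> : insub (val (h s)) = Some (h s) by exact: valK.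
  by rewrite /= hK eqxx andbT.
by move=> w /nonP pw; rewrite (insubT (fun x => [exists y, e x y]) pw) /= fK.
Qed.

Lemma iso_sum_adj : \sum_v \sum_w (e v w)%:R = 2 * (2 * t%:R + 1) :> R.
Proof.
have [g [g_inj gE sumE]] := nonisol_sum.
have inner v : \sum_w (e v w)%:R = \sum_(w | e v w) 1 :> R.
  by rewrite [RHS]big_mkcond; apply: eq_bigr => w _; case: (e v w).
have -> : \sum_v \sum_w (e v w)%:R = \sum_(v | [exists y, e v y]) \sum_(w | e v w) 1 :> R.
  rewrite [RHS]big_mkcond; apply: eq_bigr => v _; rewrite inner; case: ifPn => // /existsPn nv.
  by rewrite big_pred0 // => w; apply/negbTE.
rewrite sumE // (eq_bigl predT) => [|s]; last first.
  apply/existsP; case: s => [i|j]; last by exists (g (inl ord0)); rewrite gE.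
  by exists (g (inl (lift i ord0))); rewrite gE /= /complete_rel neq_lift.
have nb s : \sum_(w | e (g s) w) 1 = match s with inl _ => 1 + t%:R * 1 | inr _ => 2 * 1 end :> R.
  rewrite sumE; last by move=> w sw; apply/existsP; exists (g s); rewrite eg.1.
  by rewrite -join_sum; apply: eq_big => [z|[]//]; rewrite gE.
rewrite (eq_bigr _ (fun s _ => nb s)) big_sumType /= !sumr_const !card_ord -[_ *+ t]mulr_natl; ring.
Qed.

(** The vector is 1 on the edge, [2 / r] on the independent set and 0 on isolated vertices; the
    equation at an end of the edge is [1 + 2 t / r = r]. *)
Lemma iso_eigenvector (r : R) : r != 0 -> r ^+ 2 - r = 2 * t%:R ->
  exists y : T -> R, (exists v, y v != 0) /\ forall v, \sum_(w | e v w) y w = r * y v.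
Proof.
move=> r0 rE; have [g [g_inj gE sumE]] := nonisol_sum.
pose F (s : 'I_2 + 'I_t) : R := match s with inl _ => 1 | inr _ => 2 / r end.
pose y v := if [pick s | g s == v] is Some s then F s else 0.
have yg s : y (g s) = F s.
  by rewrite /y; case: pickP => [s' /eqP/g_inj->//|/(_ s)]; rewrite eqxx.
exists y; split; first by exists (g (inl ord0)); rewrite yg oner_eq0.
move=> v; case: (pickP (fun s => g s == v)) => [s /eqP <-|none].
  rewrite sumE; last by move=> w sw; apply/existsP; exists (g s); rewrite eg.1.
  have -> : \sum_(z | e (g s) (g z)) y (g z) = \sum_(z | J s z) F z.
    by apply: eq_big => z; rewrite ?gE // yg.
  rewrite join_sum yg; case: s => [i|j] /=; last by field.
  have -> : t%:R = (r ^+ 2 - r) / 2 by rewrite rE; field.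
  by field.
rewrite {2}/y; case: pickP => [s|_]; first by rewrite none.
rewrite mulr0 sumE; last by move=> w sw; apply/existsP; exists v; rewrite eg.1.
rewrite big_pred0 // => s; apply/negbTE/negP => vs.
(* A non-isolated [v] outside the image of [g] would make the sum of 1 over [v] alone equal to 0. *)
have := sumE (pred1 v) (fun=> 1); rewrite big_pred1_eq big_pred0 => [|z]; last exact: none.
move=> h; have /eqP : 1 = 0 :> R by apply: h => w /eqP->; apply/existsP; exists (g s).
by rewrite oner_eq0.
Qed.
End JoinSums.

(** Edges are two-element sets, and each is the image of exactly two ordered adjacent pairs. *)
Lemma sum_degree (T : finType) (e : rel T) : simple_graph e ->
  (\sum_v \sum_w (e v w : nat) = 2 * nedges e)%N.
Proof.
move=> [es ei]; rewrite pair_bigA /=.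
pose D := [set p : T * T | e p.1 p.2].
have -> : (\sum_p (e p.1 p.2 : nat) = #|D|)%N.
  by rewrite -sum1_card [RHS]big_mkcond /=; apply: eq_bigr => p _; rewrite inE; case: (e _ _).
rewrite -sum1_card (partition_big (fun p => [set p.1; p.2]) (mem (edges e))) /=; last first.
  by move=> p pD; apply/imsetP; exists p.
rewrite /nedges -sum1_card big_distrr /=; apply: eq_bigr => E /imsetP[[a b]].
rewrite inE /= => eab ->; rewrite sum1_card muln1.
have ab : a != b by apply: contraTneq eab => ->; rewrite ei.
suff -> : #|[pred p | (p \in D) && ([set p.1; p.2] == [set a; b])]| = #|[set (a, b); (b, a)]|.
  by rewrite cards2 xpair_eqE negb_and ab.
apply: eq_card => -[c d]; rewrite !inE /= !xpair_eqE.
apply/andP/orP => [[ecd /eqP E2]|].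
  have : c != d by apply: contraTneq ecd => ->; rewrite ei.
  have := set21 c d; have := set22 c d; rewrite E2 !inE.
  by do 2![case/orP => /eqP ->]; rewrite ?eqxx ?ab //=; auto.
case=> /andP[/eqP -> /eqP ->]; rewrite ?eab ?eqxx //; split; first by rewrite es.
by rewrite setUC.
Qed.

Lemma nedges_join (T : finType) (e : rel T) (t : nat) : simple_graph e ->
  isomorphic (nonisol_rel e) (join_rel (complete_rel 2) (empty_rel t)) ->
  nedges e = (2 * t + 1)%N.
Proof.
move=> eg iso; have := iso_sum_adj rat eg iso.
under eq_bigr => v _ do rewrite -natr_sum.
rewrite -natr_sum sum_degree //.
have -> : 2 * (2 * t%:R + 1) = (2 * (2 * t + 1))%:R :> rat by rewrite natrM natrD natrM.
by move/eqP; rewrite eqr_nat eqn_pmul2l // => /eqP.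
Qed.

From mathcomp Require Import classical_sets reals topology normedtype derive.
Import numFieldNormedType.Exports.

(** * The spectral radius *)

Section Perron.
Variable R : realType.

(** First-order condition at a minimum. The test value is [- a / (b + 1)] rather than [- a / b]
    because [b] may vanish. *)
Lemma slope_eq0 (a b : R) : 0 <= b -> (forall t, 0 <= 2 * t * a + t ^+ 2 * b) -> a = 0.
Proof.
move=> b0 /(_ (- a / (b + 1))).
have b1 : 0 < b + 1 by lra.
have -> : 2 * (- a / (b + 1)) * a + (- a / (b + 1)) ^+ 2 * b =
          - (a ^+ 2 * ((b + 2) / (b + 1) ^+ 2)) by field; lra.
rewrite oppr_ge0 pmulr_lle0 => [|]; last by apply: divr_gt0; [lra|exact: exprn_gt0].
by move=> h; apply/eqP; rewrite -sqrf_eq0 eq_le h sqr_ge0.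
Qed.

Variable n : nat.
Implicit Types v w : 'rV[R]_n.

Local Notation nrm v := (\sum_i v ord0 i ^+ 2).

Lemma nrm_ge0 v : 0 <= nrm v.
Proof. by apply: sumr_ge0 => i _; apply: sqr_ge0. Qed.

Lemma nrm_eq0 v : nrm v = 0 -> v = 0.
Proof.
move=> /eqP; rewrite psumr_eq0 => [|i _]; last exact: sqr_ge0.
move=> /allP h; apply/rowP => i; rewrite mxE; apply/eqP.
by rewrite -sqrf_eq0; apply: h; rewrite mem_index_enum.
Qed.

Lemma continuous_sumr (U : topologicalType) (I : Type) (r : seq I) (f : I -> U -> R) :
  (forall i, continuous (f i)) -> continuous (fun z => \sum_(i <- r) f i z).
Proof. by move=> cf; apply: continuous_big => //; exact: add_continuous. Qed.

Lemma sphere_compact : compact [set v : 'rV[R]_n | nrm v = 1]%classic.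
Proof.
apply: (@subclosed_compact _ _
  [set v : 'rV[R]_n | forall i, (`[-1, 1]%classic : set R) (v ord0 i)]%classic).
- have -> : [set v : 'rV[R]_n | nrm v = 1]%classic =
      ((fun v : 'rV[R]_n => nrm v) @^-1` [set x | x = 1])%classic by [].
  apply: preimage_closed; last exact: closed_eq.
  move=> v _; apply: continuous_sumr => i w.
  exact: (continuousM (@coord_continuous _ _ _ ord0 i w) (@coord_continuous _ _ _ ord0 i w)).
- apply: (@rV_compact _ _ (fun=> (`[-1, 1]%classic : set R))) => i; exact: segment_compact.
- move=> v /= v1 i; rewrite /= in_itv /= -ler_norml.
  rewrite -(@ler_pXn2r _ 2) ?nnegrE // expr1n real_normK ?num_real //.
  rewrite -v1 (bigD1 i) //= lerDl; apply: sumr_ge0 => j _; exact: sqr_ge0.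
Qed.

Variable M : 'M[R]_n.
Hypothesis symM : M^T = M.
Hypothesis M_ge0 : forall i j, 0 <= M i j.

Let bil v w := \sum_i \sum_j v ord0 i * M i j * w ord0 j.

Lemma bilC v w : bil v w = bil w v.
Proof.
rewrite /bil exchange_big /=; apply: eq_bigr => i _; apply: eq_bigr => j _.
rewrite -[in LHS]symM mxE; ring.
Qed.

Lemma bilE v w : bil v w = \sum_j (v *m M) ord0 j * w ord0 j.
Proof.
rewrite /bil exchange_big /=; apply: eq_bigr => j _.
by rewrite mxE mulr_suml; apply: eq_bigr => i _.
Qed.

Lemma bil_expand v w t : bil (v + t *: w) (v + t *: w) =
  bil v v + 2 * t * bil v w + t ^+ 2 * bil w w.
Proof.
have -> : 2 * t * bil v w = t * bil v w + t * bil w v by rewrite (bilC w v); ring.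
rewrite /bil !mulr_sumr -!big_split /=; apply: eq_bigr => i _.
rewrite !mulr_sumr -!big_split /=; apply: eq_bigr => j _.
by rewrite !mxE; ring.
Qed.

Lemma nrm_expand v w t : nrm (v + t *: w) =
  nrm v + 2 * t * (\sum_i v ord0 i * w ord0 i) + t ^+ 2 * nrm w.
Proof.
rewrite !mulr_sumr -!big_split /=; apply: eq_bigr => i _.
by rewrite !mxE; ring.
Qed.

(* A maximiser of the quadratic form on the unit sphere is an eigenvector, and
   taking absolute values of its entries does not decrease the form. *)
Lemma nonneg_sym_top_eigenvector : (0 < n)%N ->
  exists v (mu : R), [/\ v != 0, forall i, 0 <= v ord0 i, v *m M = mu *: v &
    forall a, eigenvalue M a -> a <= mu].
Proof.
move=> n0.
have [||c] := @EVT_max_rV _ n (fun v => bil v v) _ _ sphere_compact.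
- exists (\row_j (j == Ordinal n0)%:R) => /=.
  rewrite (bigD1 (Ordinal n0)) //= mxE eqxx expr1n big1 ?addr0 // => j /negPf hj.
  by rewrite mxE hj expr0n.
- apply: continuous_subspaceT.
  apply: continuous_sumr => i; apply: continuous_sumr => j v.
  have cc k := @coord_continuous R 1 n ord0 k v.
  exact: (continuousM (continuousM (cc i) (@cst_continuous _ _ (M i j) v)) (cc j)).
rewrite classical_sets.inE /= => c1 cmax.
pose v := (\row_i `|c ord0 i|) : 'rV[R]_n.
have v1 : nrm v = 1.
  by rewrite -c1; apply: eq_bigr => i _; rewrite mxE real_normK ?num_real.
have cv : bil c c <= bil v v.
  apply: ler_sum => i _; apply: ler_sum => j _; rewrite !mxE.
  apply: le_trans (ler_norm _) _.
  by rewrite !normrM (ger0_norm (M_ge0 i j)).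
set mu := bil v v in cv.
(* By homogeneity, the maximum on the sphere bounds the form everywhere. *)
have vmax w : bil w w <= mu * nrm w.
  have [/eqP w0|w0] := boolP (nrm w == 0).
    have -> := nrm_eq0 w0.
    rewrite /bil big1 ?big1 ?mulr0 // => i _; rewrite ?mxE ?expr0n //=.
    by rewrite big1 // => j _; rewrite !mxE; ring.
  have wp : 0 < nrm w by rewrite lt_def w0 nrm_ge0.
  pose s := Num.sqrt (nrm w).
  have s0 : 0 < s by rewrite sqrtr_gt0.
  have s2 : s ^+ 2 = nrm w by rewrite sqr_sqrtr // ltW.
  have h1 : nrm (s^-1 *: w) = 1.
    under eq_bigr => i _ do rewrite mxE exprMn.
    by rewrite -mulr_sumr -s2 exprVn mulVf // expf_neq0 // gt_eqF.
  have : bil (s^-1 *: w) (s^-1 *: w) <= mu.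
    by apply: le_trans (cmax _ _) cv; rewrite classical_sets.inE.
  have -> : bil (s^-1 *: w) (s^-1 *: w) = bil w w / nrm w.
    rewrite -s2 /bil mulr_suml; apply: eq_bigr => i _; rewrite mulr_suml; apply: eq_bigr => j _.
    by rewrite !mxE; field; rewrite gt_eqF.
  by rewrite ler_pdivrMr.
exists v, mu; split.
- apply/eqP => v0; move: v1; rewrite v0 big1 => [|i _]; last by rewrite mxE; ring.
  by move/eqP; rewrite eq_sym oner_eq0.
- by move=> i; rewrite mxE.
(* Moving from [v] in the direction of the residual [z] changes [mu * nrm - bil] to first order by
   [2 * t * nrm z]; this quantity is nonnegative and vanishes at [v], so [z = 0]. *)
- pose z := mu *: v - v *m M.
  have h w : (\sum_i z ord0 i * w ord0 i) = mu * (\sum_i v ord0 i * w ord0 i) - bil v w.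
    rewrite bilE mulr_sumr -sumrB; apply: eq_bigr => i _; rewrite !mxE; ring.
  suff : z = 0 by move/eqP; rewrite subr_eq0 => /eqP.
  apply: nrm_eq0; under eq_bigr => i _ do rewrite expr2.
  apply: (@slope_eq0 _ (mu * nrm z - bil z z)); first by rewrite subr_ge0.
  move=> t; have := vmax (v + t *: z).
  rewrite nrm_expand bil_expand v1 h -/mu; lra.
- move=> a /eigenvalueP[w wa w0].
  have wp : 0 < nrm w.
    by rewrite lt_def nrm_ge0 andbT; apply: contra_neq w0; exact: nrm_eq0.
  have := vmax w; rewrite bilE wa.
  have -> : \sum_j (a *: w) ord0 j * w ord0 j = a * nrm w.
    by rewrite mulr_sumr; apply: eq_bigr => j _; rewrite mxE; ring.
  by rewrite ler_pM2r.
Qed.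
End Perron.

(** * Adjacency eigenvectors as functions on the vertices *)

Section GraphSpectrum.
Variables (R : realType) (T : finType) (e : rel T).

Lemma sum_enum_val (P : pred T) (y : T -> R) :
  \sum_(i < #|T|) (P (enum_val i))%:R * y (enum_val i) = \sum_(w | P w) y w.
Proof.
rewrite [RHS]big_mkcond /= [RHS](big_enum_val) /=.
by apply: eq_bigr => i _; case: (P _); rewrite ?mul1r ?mul0r.
Qed.

Lemma mulmx_adjmx (y : T -> R) (i : 'I_#|T|) : symmetric e ->
  ((\row_j y (enum_val j)) *m adjmx R e) ord0 i = \sum_(w | e (enum_val i) w) y w.
Proof.
move=> es; rewrite mxE -(sum_enum_val (e (enum_val i))).
by apply: eq_bigr => j _; rewrite !mxE es mulrC.
Qed.

Lemma eigenvalue_adjmx (a : R) (y : T -> R) : symmetric e ->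
  (exists v, y v != 0) -> (forall v, \sum_(w | e v w) y w = a * y v) ->
  eigenvalue (adjmx R e) a.
Proof.
move=> es [v yv] ya; apply/eigenvalueP.
exists (\row_j y (enum_val j)).
  by apply/rowP => i; rewrite mulmx_adjmx // ya !mxE.
apply/eqP => /rowP/(_ (enum_rank v)); rewrite !mxE enum_rankK => /eqP.
exact/negP.
Qed.

(** The top eigenvalue [mu] is itself an eigenvalue and bounds all others, so it is the supremum
    defining [spec_rad]. The nonnegative eigenvector is then divided by its largest entry. *)
Lemma spec_rad_perron : symmetric e -> (0 < #|T|)%N ->
  exists x : T -> R, [/\ forall v, 0 <= x v, forall v, x v <= 1,
    exists u, x u = 1,
    forall v, \sum_(w | e v w) x w = spec_rad R e * x v &
    forall a, eigenvalue (adjmx R e) a -> a <= spec_rad R e].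
Proof.
move=> es T0.
have symA : (adjmx R e)^T = adjmx R e by apply/matrixP => i j; rewrite !mxE es.
have A0 i j : 0 <= adjmx R e i j by rewrite mxE ler0n.
have [v [mu [v0 v_ge0 vA mumax]]] := nonneg_sym_top_eigenvector symA A0 T0.
have muE : eigenvalue (adjmx R e) mu by apply/eigenvalueP; exists v.
have -> : spec_rad R e = mu.
  apply/eqP; rewrite eq_le; apply/andP; split.
    by apply: ge_sup; [exists mu | move=> a /mumax].
  apply: ub_le_sup => //; by exists mu => a /mumax.
pose y w := v ord0 (enum_rank w).
have [u _ umax] := Order.TotalTheory.arg_maxP y (erefl : predT (enum_val (Ordinal T0))).
have yu : 0 < y u.
  rewrite lt_def v_ge0 andbT; apply: contra_neq v0 => yu0.
  apply/rowP => i; rewrite mxE; apply/eqP; rewrite eq_le v_ge0 andbT -yu0.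
  by have := umax (enum_val i) isT; rewrite /y enum_valK.
exists (fun w => y w / y u); split => //.
- by move=> w; apply: divr_ge0; [exact: v_ge0 | exact: ltW].
- by move=> w; rewrite ler_pdivrMr // mul1r; exact: umax.
- by exists u; rewrite divff // gt_eqF.
- move=> w; rewrite -mulr_suml mulrA; congr (_ / _).
  have := mulmx_adjmx y (enum_rank w) es; rewrite enum_rankK => <-.
  have -> : \row_j y (enum_val j) = v by apply/rowP => j; rewrite mxE /y enum_valK.
  by rewrite vA mxE.
Qed.
End GraphSpectrum.

Theorem theorem1p2 (R : realType) (T : finType) (e : rel T) :
  simple_graph e -> F6_free e -> (88 <= nedges e)%N ->
  spec_rad R e <= (1 + Num.sqrt (4 * (nedges e)%:R - 3)) / 2 /\
  (spec_rad R e = (1 + Num.sqrt (4 * (nedges e)%:R - 3)) / 2 <->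
   isomorphic (nonisol_rel e)
     (join_rel (complete_rel 2) (empty_rel ((nedges e - 1) %/ 2)))).
Proof.
move=> eg free m88; have [es ei] := eg.
have T0 : (0 < #|T|)%N.
  have /card_gt0P[E /imsetP[p _ _]] : (0 < #|edges e|)%N by apply: leq_trans m88.
  by apply/card_gt0P; exists p.1.
have [x [x_ge0 x_le1 [u xu] eig max_eig]] := spec_rad_perron R es T0.
set m := nedges e in m88 *; set r := spec_rad R e in eig max_eig *.
set r0 := (_ / 2).
have mR : 88 <= m%:R :> R by rewrite (ler_nat R 88).
have sq : Num.sqrt (4 * m%:R - 3) ^+ 2 = 4 * m%:R - 3 :> R by rewrite sqr_sqrtr //; lra.
have s_ge0 := sqrtr_ge0 (4 * m%:R - 3 : R).
have r0E : r0 ^+ 2 - r0 = m%:R - 1 by move: sq; rewrite /r0; set s := Num.sqrt _; lra.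
(* For [m >= 88] the square root is at least [sqrt 349 > 17]. *)
have r09 : 9 <= r0.
  suff : 17 <= Num.sqrt (4 * m%:R - 3) :> R by rewrite /r0; lra.
  by move: sq s_ge0; set s := Num.sqrt _ => sq s_ge0; rewrite leNgt; apply/negP => s17; nra.
have adjE : (\sum_v \sum_w (e v w)%:R) / 2 = m%:R :> R.
  under eq_bigr => v _ do rewrite -natr_sum.
  by rewrite -natr_sum sum_degree // natrM; field.
(* If [r > r0 >= 9], the link argument applies to [r], and [r ^+ 2 - r <= r0 ^+ 2 - r0] contradicts
   monotonicity. *)
have le_r : r <= r0.
  rewrite leNgt; apply/negP => r0r.
  have r9 : 9 <= r by lra.
  have := spectral_bound es ei free x_ge0 x_le1 xu eig r9; rewrite adjE -r0E.
  nra.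
split => //; split => [rE|iso].
  have r9 : 9 <= r by rewrite rE.
  have [|c [uc out star]] := extremal_star es ei free x_ge0 x_le1 xu eig r9.
    by rewrite adjE rE r0E.
  rewrite inE in uc.
  have iso : isomorphic (nonisol_rel e)
      (join_rel (complete_rel 2) (empty_rel #|[set w | e u w] :\ c|)).
    apply: book_isomorphic => // [v w vu uv|v w uv uw]; first by apply: out; rewrite inE vu.
    by apply: star; rewrite inE.
  (* The edge count [m = 2 t + 1] of the join recovers the size [t] of the independent set. *)
  suff -> : ((m - 1) %/ 2)%N = #|[set w | e u w] :\ c| by [].
  by rewrite /m (nedges_join eg iso) addnK mulKn.
(* Conversely, [r0 ^+ 2 - r0 = m - 1 = 2 t] makes [r0] an eigenvalue, hence at most [r]. *)
apply/eqP; rewrite eq_le le_r /=.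
have mE := nedges_join eg iso; rewrite -/m in mE.
have [||y [y0 yE]] := iso_eigenvector (R := R) eg iso (r := r0).
- by rewrite gt_eqF //; lra.
- by rewrite r0E {1}mE natrD natrM; ring.
exact: max_eig (eigenvalue_adjmx es y0 yE).
Qed.
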